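(* Let $\mathbf X,\mathbf Y,\mathbf Z,\mathbf S$ be pairwise disjoint node sets in a causal DAG $\mathcal D$ with $\mathbf Z\cap\mathrm{De}(\mathbf X,\mathcal D)=\emptyset$. If $\mathbf S$ is a conditional adjustment set relative to $(\mathbf X,\mathbf Y,\mathbf Z)$ in $\mathcal D$, then $\mathbf S$ satisfies the conditional adjustment criterion relative to $(\mathbf X,\mathbf Y,\mathbf Z)$ in $\mathcal D$.
   Context: DAG setting. In a DAG $\mathcal D=(\mathbf V,\mathbf E)$, a path is a sequence of distinct nodes with successive nodes adjacent; a path from $\mathbf X$ to $\mathbf Y$ runs from some $X\in\mathbf X$ to some $Y\in\mathbf Y$ and is proper if only its first node is in $\mathbf X$. A path $X\to\cdots\to Y$ is causal; otherwise it is non-causal. A non-endpoint $V_j$ on a path is a collider if $V_{j-1}\to V_j\leftarrow V_{j+1}$, else a non-collider. Descendants $\mathrm{De}$ and ancestors $\mathrm{An}$ include the node itself. A path is d-connecting given $\mathbf Z$ if no non-collider on it is in $\mathbf Z$ and every collider on it has a descendant in $\mathbf Z$; otherwise blocked. Mediators of $\mathbf X,\mathbf Y$: all non-first nodes on proper causal paths from $\mathbf X$ to $\mathbf Y$; $\mathrm{Forb}(\mathbf X,\mathbf Y,\mathcal D)=\mathrm{De}(\text{mediators},\mathcal D)$. Causal semantics. Densities are positive. A family $\{f(\mathbf v\mid do(\mathbf x')):\mathbf X'\subseteq\mathbf V\}$ is compatible with causal $\mathcal D$ if each member equals $\prod_{V_i\in\mathbf V\setminus\mathbf X'}f(v_i\mid\mathrm{pa}(v_i,\mathcal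 D))\mathbb 1(\mathbf X'=\mathbf x')$; an interventional density is consistent with $\mathcal D$ if it belongs to such a family. Conditional adjustment set: $\mathbf S$ is one relative to $(\mathbf X,\mathbf Y,\mathbf Z)$ in $\mathcal D$ if for every density $f$ consistent with $\mathcal D$, $f(\mathbf y\mid do(\mathbf x),\mathbf z)=f(\mathbf y\mid\mathbf x,\mathbf z)$ when $\mathbf S=\emptyset$ and $=\int f(\mathbf y\mid\mathbf x,\mathbf z,\mathbf s)f(\mathbf s\mid\mathbf z)d\mathbf s$ otherwise. Conditional adjustment criterion (in a DAG, with $\mathbf Z\cap\mathrm{De}(\mathbf X,\mathcal D)=\emptyset$): (a) $\mathbf S\cap\mathrm{Forb}(\mathbf X,\mathbf Y,\mathcal D)=\emptyset$ and (b) $\mathbf S\cup\mathbf Z$ blocks all proper non-causal paths from $\mathbf X$ to $\mathbf Y$ in $\mathcal D$. *)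

(* Defs.v *)
From HB Require Import structures.
From mathcomp Require Import all_boot all_order all_algebra.
From mathcomp Require Import reals.
Set Implicit Arguments. Unset Strict Implicit. Unset Printing Implicit Defensive.
Import Order.TTheory GRing.Theory Num.Theory.

Section Graph.
Variable V : finType.
Variable E : rel V.

Definition dag : Prop := forall a b : V, E a b -> ~~ connect E b a.

Definition adj (a b : V) : bool := E a b || E b a.

Definition is_path (s : seq V) : bool :=
  if s is a :: t then uniq s && path adj a t else false.

Definition causal_path (s : seq V) : bool :=
  if s is a :: t then path E a t else false.

Definition proper_from_to (X Y : {set V}) (s : seq V) : bool :=
  if s is a :: t then [&& a \in X, last a t \in Y & all (fun v => v \notin X) t]
  else false.

Definition De (A : {set V}) : {set V} := [set w | [exists a in A, connect E a w]].

Definition collider_at (s : seq V) (j : nat) : bool :=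
  if s is a0 :: _ then
    E (nth a0 s j.-1) (nth a0 s j) && E (nth a0 s j.+1) (nth a0 s j)
  else false.

Definition d_connecting (Z : {set V}) (s : seq V) : Prop :=
  if s is a0 :: _ then
    forall j : nat, 0 < j -> j < (size s).-1 ->
      (collider_at s j -> exists2 w, w \in Z & connect E (nth a0 s j) w) /\
      (~~ collider_at s j -> nth a0 s j \notin Z)
  else False.

Definition blocked (Z : {set V}) (s : seq V) : Prop := ~ d_connecting Z s.

Definition mediator (X Y : {set V}) (m : V) : Prop :=
  exists s : seq V, [/\ is_path s, causal_path s, proper_from_to X Y s & m \in behead s].

Definition in_Forb (X Y : {set V}) (w : V) : Prop :=
  exists2 m, mediator X Y m & connect E m w.

Definition cond_adj_criterion (X Y Z S : {set V}) : Prop :=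
  (forall w, w \in S -> ~ in_Forb X Y w) /\
  (forall s : seq V, is_path s -> proper_from_to X Y s -> ~~ causal_path s ->
     blocked (S :|: Z) s).

End Graph.

(* Causal semantics, with every variable taking values in a finite state      *)
(* space T (densities w.r.t. counting measure).                               *)
Section Semantics.
Local Open Scope ring_scope.
Variable R : realType.
Variable V : finType.
Variable E : rel V.
Variable T : finType.

Notation cfg := {ffun V -> T}.

Definition asg (A : {set V}) := {ffun {i : V | i \in A} -> T}.

Definition agree (A : {set V}) (a : asg A) (v : cfg) : bool :=
  [forall i : {i : V | i \in A}, v (val i) == a i].

(* kernel k i v t = f(v_i = t | pa(v_i)), pa values read off v *)
Definition causal_kernels (k : V -> cfg -> T -> R) : Prop :=
  [/\ (forall i (v w : cfg), (forall j, E j i -> v j = w j) -> forall t, k i v t = k i w t),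
      (forall i (v : cfg) t, 0 < k i v t) &
      (forall i (v : cfg), \sum_(t : T) k i v t = 1)].

(* f(v | do(x')) = prod_{i notin X'} f(v_i|pa(v_i)) 1(X' = x') ;
   X' = set0 gives the observational density f(v) *)
Definition do_density (k : V -> cfg -> T -> R) (X : {set V}) (x : asg X) (v : cfg) : R :=
  (\prod_(i | i \notin X) k i v (v i)) * (agree x v)%:R.

Definition obs_density (k : V -> cfg -> T -> R) (v : cfg) : R :=
  \prod_i k i v (v i).

Definition Pr (f : cfg -> R) (P : pred cfg) : R := \sum_(v | P v) f v.

End Semantics.

Local Open Scope ring_scope.
Definition cond_adjustment_set (R : realType) (V : finType) (E : rel V)
    (X Y Z S : {set V}) : Prop :=
  forall (T : finType) (k : V -> {ffun V -> T} -> T -> R),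
    causal_kernels E k ->
    forall (x : asg T X) (y : asg T Y) (z : asg T Z),
      let fdo := do_density k x in
      let f := obs_density k in
      Pr fdo (fun v => agree y v && agree z v) / Pr fdo (fun v => agree z v) =
      if S == set0 then
        Pr f (fun v => [&& agree y v, agree x v & agree z v]) /
        Pr f (fun v => agree x v && agree z v)
      else
        \sum_(s : asg T S)
          (Pr f (fun v => [&& agree y v, agree x v, agree z v & agree s v]) /
           Pr f (fun v => [&& agree x v, agree z v & agree s v])) *
          (Pr f (fun v => agree s v && agree z v) / Pr f (fun v => agree z v)).

(* Main.v *)
From mathcomp Require Import classical_sets topology normedtype derive.
Import numFieldNormedType.Exports.
Require Import Defs.
From HB Require Import structures.
From mathcomp Require Import all_boot all_order all_algebra.
From mathcomp Require Import reals.
From mathcomp Require Import zify.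
Set Implicit Arguments. Unset Strict Implicit. Unset Printing Implicit Defensive.
Import Order.TTheory GRing.Theory Num.Theory.

(** Approximation by positive kernels extends the adjustment identity to
    structural equation models with uniform noise, where probabilities are
    proportional to numbers of noise assignments. If the criterion fails, the
    DAG contains one of the following, where "observed" means: having a
    descendant in S or Z along a path that avoids X.
    - A mediator m of x and y with a descendant in S. Let m := x && noise and
      let S and y see m: adjusting averages y over the observational law of m.
    - Forks r_0, ..., r_k and observed colliders c_1, ..., c_k with
      r_0 -> c_1 <- r_1 -> ... -> c_k <- r_k -> y and, moreover, either r_0 -> x
      or x -> c_0 <- r_0 with c_0 observed. Every r_j emits a fair bit; every
      c_j, j > 0, tells whether the two bits reaching it agree and reveals them
      if they do not. Given these reports, either all bits are known or they
      all equal one unknown bit, which y sees; in the second case X = x (resp.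
      X = x and the report of c_0) favours one value of that bit, so that
      adjusting gives y the wrong law. *)

(** * Limits of ratios of polynomials *)

Section Limits.
Local Open Scope ring_scope.
Variable R : realType.

Lemma horner_cvg0 (p : {poly R}) : (p.[t] @[t --> 0^'+] --> p.[0])%classic.
Proof. by apply: cvg_at_right_filter; apply: continuous_horner. Qed.

(* Where [d i] vanishes at 0, the bound [c i / d i <= 1] makes the term tend to
   0, which is also its junk value. *)
Lemma ratio_sum_limit (I : finType) (a b h : {poly R}) (c d g : I -> {poly R}) :
  b.[0] != 0 -> h.[0] != 0 ->
  (forall i, (d i).[0] != 0 \/ (g i).[0] = 0) ->
  (forall i t, 0 < t < 1 -> 0 <= (c i).[t] <= (d i).[t]) ->
  (forall i t, 0 < t < 1 -> 0 <= (g i).[t] / h.[t]) ->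
  (forall t, 0 < t < 1 ->
     a.[t] / b.[t] = \sum_i (c i).[t] / (d i).[t] * ((g i).[t] / h.[t])) ->
  a.[0] / b.[0] = \sum_i (c i).[0] / (d i).[0] * ((g i).[0] / h.[0]).
Proof.
move=> b0 h0 dg cd gh eq_t.
have near01 : (\forall t \near (0 : R)^'+, 0 < t < 1)%classic.
  near=> t; apply/andP; split; near: t; [exact: nbhs_right_gt | exact: nbhs_right_lt].
have cvg_ratio (p q : {poly R}) : q.[0] != 0 ->
    (p.[t] / q.[t] @[t --> 0^'+] --> p.[0] / q.[0])%classic.
  by move=> q0; apply: cvgM; [exact: horner_cvg0 | apply: cvgV => //; exact: horner_cvg0].
have cvg_rhs : ((\sum_i (c i).[t] / (d i).[t] * ((g i).[t] / h.[t])) @[t --> 0^'+]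
    --> \sum_i (c i).[0] / (d i).[0] * ((g i).[0] / h.[0]))%classic.
  apply: cvg_big => [|i _]; first exact: add_continuous.
  case: (dg i) => [d0|g0]; first by apply: cvgM; apply: cvg_ratio.
  rewrite g0 mul0r mulr0.
  apply: (@squeeze_cvgr _ _ _ _ (fun=> 0) (fun t => (g i).[t] / h.[t])).
  - near=> t; have t01 : 0 < t < 1 by near: t.
    have /andP[c_ge0 c_le] := cd i t t01; have gh_ge0 := gh i t t01.
    have d_ge0 := le_trans c_ge0 c_le.
    apply/andP; split; first by apply: mulr_ge0 => //; apply: divr_ge0.
    apply: ler_piMl => //; have [-> | d_neq0] := eqVneq (d i).[t] 0; first by rewrite invr0 mulr0.
    by rewrite ler_pdivrMr ?mul1r // lt0r d_neq0.
  - exact: cvg_cst.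
  - by have := cvg_ratio (g i) h h0; rewrite g0 mul0r.
have cvg_lhs := cvg_ratio a b b0.
apply: (cvg_unique (@norm_hausdorff _ _) cvg_lhs).
apply: cvg_trans cvg_rhs; apply: near_eq_cvg; near=> t.
by apply/esym/eq_t; near: t.
Unshelve. all: by end_near. Qed.

Definition polyfun (f : R -> R) := exists p : {poly R}, forall t, f t = p.[t].

Lemma polyfun_cst x : polyfun (fun=> x).
Proof. by exists x%:P => t; rewrite hornerC. Qed.

Lemma polyfunM f g : polyfun f -> polyfun g -> polyfun (fun t => f t * g t).
Proof. by move=> [p fE] [q gE]; exists (p * q) => t; rewrite hornerM fE gE. Qed.

Lemma polyfun_sum (I : finType) (P : pred I) (f : I -> R -> R) :
  (forall i, polyfun (f i)) -> polyfun (fun t => \sum_(i | P i) f i t).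
Proof.
move=> /fin_all_exists[p fE]; exists (\sum_(i | P i) p i) => t.
by rewrite horner_sum; apply: eq_bigr => i _; apply: fE.
Qed.

Lemma polyfun_prod (I : finType) (P : pred I) (f : I -> R -> R) :
  (forall i, polyfun (f i)) -> polyfun (fun t => \prod_(i | P i) f i t).
Proof.
move=> /fin_all_exists[p fE]; exists (\prod_(i | P i) p i) => t.
by rewrite horner_prod; apply: eq_bigr => i _; apply: fE.
Qed.

End Limits.

(** * Structural equations *)

Section StructuralEquations.
Local Open Scope ring_scope.
Variables (V : finType) (E : rel V) (T N : finType).
Hypothesis dagE : dag E.
Notation cfg := {ffun V -> T}.
Implicit Types (F : V -> cfg -> N -> T) (u : {ffun V -> N}) (v w : cfg).

Definition local_mech F := forall i v w n,
  (forall j, E j i -> v j = w j) -> F i v n = F i w n.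

(** The number of ancestors, at least 1 since a node is its own ancestor: a rank that bounds the
    rounds needed to solve the equations. *)
Definition depth i := #|[set j | connect E j i]|.

Lemma depth_lt i j : E i j -> (depth i < depth j)%N.
Proof.
move=> Eij; apply/proper_card/properP; split.
  apply/subsetP => l; rewrite !inE => /connect_trans; apply; exact: connect1.
by exists j; rewrite !inE ?connect0 //; apply: dagE.
Qed.

Lemma dag_ind (P : V -> Prop) :
  (forall i, (forall j, E j i -> P j) -> P i) -> forall i, P i.
Proof.
move=> IH i; have [n] := ubnP (depth i); elim: n i => // n IHn i lt_n.
by apply: IH => j Eji; apply: IHn; apply: leq_trans (depth_lt Eji) _.
Qed.

Definition mech_step F u v : cfg := [ffun i => F i v (u i)].

Definition solve t0 F u : cfg := iter #|V| (mech_step F u) [ffun=> t0].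

(** A node of depth at most [n] forgets the start within [n] rounds, its parents having smaller
    depth; so [#|V|] rounds settle every node. *)
Lemma iter_mech_step F u n v w i : local_mech F -> (depth i <= n)%N ->
  iter n (mech_step F u) v i = iter n (mech_step F u) w i.
Proof.
move=> locF; elim: n i => [|n IHn] i le_n.
  by move: le_n; rewrite leqn0 cards_eq0 => /eqP/setP/(_ i); rewrite !inE connect0.
rewrite !iterS !ffunE; apply: locF => j Eji; apply: IHn.
by rewrite -ltnS; apply: leq_trans (depth_lt Eji) _.
Qed.

Lemma solveE t0 F u i : local_mech F -> solve t0 F u i = F i (solve t0 F u) (u i).
Proof.
move=> locF; transitivity (mech_step F u (solve t0 F u) i); last by rewrite ffunE.
by rewrite -iterS iterSr; apply: iter_mech_step => //; apply: max_card.
Qed.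

(** A configuration satisfying all equations is fixed by [mech_step], and [solve] may as well start
    from it: solutions are unique. *)
Lemma solveP t0 F u v : local_mech F ->
  (v == solve t0 F u) = [forall i, F i v (u i) == v i].
Proof.
move=> locF; apply/eqP/forallP => [-> i|vP]; first by rewrite -solveE.
apply/ffunP => i; rewrite /solve (iter_mech_step _ _ v locF (max_card _)).
have stepv : mech_step F u v = v by apply/ffunP => j; rewrite ffunE; apply/eqP.
by rewrite iter_fix.
Qed.

Variable R : realType.

Definition mech_kernel F i v t : R := #|[set n | F i v n == t]|%:R / #|N|%:R.

Lemma mech_kernel_local F i v w : local_mech F -> (forall j, E j i -> v j = w j) ->
  forall t, mech_kernel F i v t = mech_kernel F i w t.
Proof.
move=> locF vw t; congr (_%:R / _); apply: eq_card => n.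
by rewrite !inE (locF _ _ _ _ vw).
Qed.

Lemma mech_kernel_ge0 F i v t : 0 <= mech_kernel F i v t.
Proof. by rewrite divr_ge0. Qed.

Hypothesis N_gt0 : (0 < #|N|)%N.

Lemma mech_kernel_sum1 F i v : \sum_t mech_kernel F i v t = 1.
Proof.
rewrite -mulr_suml; apply: (canLR (mulfK _)); rewrite ?pnatr_eq0 -?lt0n // mul1r -natr_sum.
congr (_%:R); rewrite -sum1_card (partition_big (F i v) predT) //=.
by apply: eq_bigr => t _; rewrite -sum1_card; apply: eq_bigl => n; rewrite inE.
Qed.

(** When the product of noise counts is expanded, [u] contributes to [v] exactly when [v] solves the
    equations with noise [u]. *)
Lemma Pr_mech t0 F (P : pred cfg) : local_mech F ->
  Pr (fun v => \prod_i mech_kernel F i v (v i)) P =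
  #|[set u | P (solve t0 F u)]|%:R / (#|N| ^ #|V|)%:R.
Proof.
move=> locF; rewrite /Pr.
have prodE v : \prod_i mech_kernel F i v (v i) =
    (\sum_u (v == solve t0 F u)%:R) / (#|N| ^ #|V|)%:R.
  rewrite big_split /= prodr_const natrX exprVn; congr (_ * _).
  under eq_bigr => i _ do rewrite -sum1_card natr_sum.
  rewrite bigA_distr_big_dep /= [RHS](bigID (fun u => v == solve t0 F u)) /=.
  rewrite [X in _ = _ + X]big1 ?addr0; last by move=> u /negbTE->.
  rewrite (eq_bigl (fun u => v == solve t0 F u)) => [|u].
    by apply: eq_bigr => u ->; rewrite big1.
  by rewrite solveP //; apply/forallP/forallP => uP i; move: (uP i); rewrite inE.
under eq_bigr => v _ do rewrite prodE.
rewrite -mulr_suml exchange_big /= -[#|[set u | _]|]sum1_card natr_sum; congr (_ / _).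
rewrite [RHS]big_mkcond.
apply: eq_bigr => u _ /=; rewrite inE; have [Pu|nPu] := ifPn.
  rewrite (bigD1 (solve t0 F u)) //= eqxx big1 ?addr0 // => v /andP[_ /negbTE->] //.
rewrite big1 // => v Pv; case: eqP => // vE; by rewrite -vE Pv in nPu.
Qed.

End StructuralEquations.

(** * Extension to nonnegative kernels *)

Section Assignments.
Local Open Scope ring_scope.
Variables (V T : finType).
Notation cfg := {ffun V -> T}.

Definition restr (A : {set V}) (v : cfg) : asg T A := [ffun i => v (val i)].

Lemma agreeE (A : {set V}) (a : asg T A) v : agree a v = (a == restr A v).
Proof.
apply/forallP/eqP => [va|-> i]; last by rewrite ffunE.
by apply/ffunP => i; rewrite ffunE (eqP (va i)).
Qed.

Lemma restr_eqP (A : {set V}) (v w : cfg) :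
  reflect {in A, v =1 w} (restr A v == restr A w).
Proof.
apply: (iffP eqP) => [/ffunP vw i Ai|vw]; first by have := vw (Sub i Ai); rewrite !ffunE.
by apply/ffunP => i; rewrite !ffunE vw // (valP i).
Qed.

Lemma agree_set0 (a : asg T (@set0 V)) v : agree a v.
Proof. by apply/forallP => -[i i0]; have := i0; rewrite inE. Qed.

Lemma card_asg_set0 : #|asg T (@set0 V)| = 1%N.
Proof.
rewrite card_ffun card_sig (_ : #|[pred x in @set0 V]| = 0%N) ?expn0 //.
by apply: eq_card0 => i; rewrite !inE.
Qed.

Section Pr.
Variables (R : realType) (f : cfg -> R).

Lemma eq_Pr (g : cfg -> R) (P Q : pred cfg) : f =1 g -> P =1 Q -> Pr f P = Pr g Q.
Proof. by move=> fg PQ; apply: eq_big. Qed.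

Lemma Pr_restr (A : {set V}) (Q : pred (asg T A)) (B : pred cfg) :
  Pr f (fun v => Q (restr A v) && B v) = \sum_(a | Q a) Pr f (fun v => agree a v && B v).
Proof.
rewrite /Pr (partition_big (restr A) Q) => [|v /andP[]//]; apply: eq_bigr => a Qa.
apply: eq_bigl => v; rewrite agreeE eq_sym andbC.
by case: eqP => //= <-; rewrite Qa.
Qed.

Hypothesis f_ge0 : forall v, 0 <= f v.

Lemma Pr_ge0 P : 0 <= Pr f P.
Proof. by apply: sumr_ge0. Qed.

Lemma le_Pr (P Q : pred cfg) : (forall v, P v -> Q v) -> Pr f P <= Pr f Q.
Proof.
move=> PQ; rewrite /Pr [leRHS](bigID P) /= (eq_bigl P); first by rewrite lerDl sumr_ge0.
by move=> v; rewrite andbC; case: (boolP (P v)) => // /PQ->.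
Qed.

Lemma Pr_gt0_ex P : 0 < Pr f P -> exists v, P v.
Proof.
move=> P_gt0; apply/existsP; apply: contraLR P_gt0; rewrite negb_exists => /forallP nP.
by rewrite /Pr big_pred0 ?ltxx // => v; apply/negbTE/nP.
Qed.

End Pr.

Lemma Pr_gt0 (R : realType) (f : cfg -> R) (P : pred cfg) v :
  (forall v, 0 < f v) -> P v -> 0 < Pr f P.
Proof.
move=> f_gt0 Pv; rewrite /Pr (bigD1 v) //=; apply: ltr_pwDl => //.
by apply: sumr_ge0 => w _; apply: ltW.
Qed.

End Assignments.

Section PositiveApproximation.
Local Open Scope ring_scope.
Variables (R : realType) (V : finType) (E : rel V) (X Y Z S : {set V}).
Hypothesis adjS : cond_adjustment_set R E X Y Z S.
Variable T : finType.
Notation cfg := {ffun V -> T}.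
Variable k : V -> cfg -> T -> R.
Hypothesis k_local : forall i (v w : cfg), (forall j, E j i -> v j = w j) -> forall t, k i v t = k i w t.
Hypothesis k_ge0 : forall i (v : cfg) t, 0 <= k i v t.
Hypothesis k_sum1 : forall i (v : cfg), \sum_t k i v t = 1.

(** Mixing with the uniform law makes the kernels positive and keeps all probabilities polynomial in
    [e]. *)
Definition perturb (e : R) i v t := (1 - e) * k i v t + e / #|T|%:R.

Lemma perturb_causal e : 0 < e < 1 -> causal_kernels E (perturb e).
Proof.
move=> /andP[e_gt0 e_lt1]; split=> [i v w vw t|i v t|i v].
- by rewrite /perturb (k_local vw).
- have T_gt0 : (0 < #|T|)%N by apply/card_gt0P; exists t.
  by rewrite /perturb ltr_wpDl ?divr_gt0 ?ltr0n // mulr_ge0 // subr_ge0 ltW.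
- rewrite big_split /= -mulr_sumr k_sum1 mulr1 sumr_const -[_ *+ _]mulr_natr.
  rewrite -mulrA mulVf ?mulr1 ?subrK // pnatr_eq0; apply/eqP => T0.
  have := k_sum1 i v; rewrite big_pred0 => [/esym/eqP|t]; first by rewrite oner_eq0.
  by have /card0_eq/(_ t) := T0; rewrite inE.
Qed.

Lemma polyfun_perturb i v t : polyfun (fun e => perturb e i v t).
Proof.
exists ((1 - 'X) * (k i v t)%:P + 'X * (#|T|%:R^-1)%:P) => e.
by rewrite !hornerE.
Qed.

Lemma polyfun_obs P : polyfun (fun e => Pr (obs_density (perturb e)) P).
Proof.
by apply: polyfun_sum => v; apply: polyfun_prod => i; apply: polyfun_perturb.
Qed.

Lemma polyfun_do (x : asg T X) P : polyfun (fun e => Pr (do_density (perturb e) x) P).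
Proof.
apply: polyfun_sum => v; apply: polyfunM; last exact: polyfun_cst.
by apply: polyfun_prod => i; apply: polyfun_perturb.
Qed.

Lemma perturb0 i v t : perturb 0 i v t = k i v t.
Proof. by rewrite /perturb subr0 mul1r mul0r addr0. Qed.

Lemma obs_perturb0 v : obs_density (perturb 0) v = obs_density k v.
Proof. by apply: eq_bigr => i _; rewrite perturb0. Qed.

Lemma do_perturb0 (x : asg T X) v : do_density (perturb 0) x v = do_density k x v.
Proof. by congr (_ * _); apply: eq_bigr => i _; rewrite perturb0. Qed.

Lemma obs_perturb_gt0 e v : 0 < e < 1 -> 0 < obs_density (perturb e) v.
Proof. by move=> /perturb_causal[_ gt0 _]; apply: prodr_gt0. Qed.

(** For [0 < e < 1] the perturbed kernels obey the identity, whose sides are built from polynomials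
    in [e]; then [e] tends to 0. The last hypothesis lets a stratum exclude [x] only when its weight
    vanishes. *)
Lemma cond_adjustment_limit (x : asg T X) (y : asg T Y) (z : asg T Z) :
  let fdo := do_density k x in
  let f := obs_density k in
  0 < Pr fdo (fun v => agree z v) -> 0 < Pr f (fun v => agree z v) ->
  (forall s : asg T S, 0 < Pr f (fun v => [&& agree x v, agree z v & agree s v]) \/
     Pr f (fun v => agree s v && agree z v) = 0) ->
  Pr fdo (fun v => agree y v && agree z v) / Pr fdo (fun v => agree z v) =
  \sum_(s : asg T S)
    (Pr f (fun v => [&& agree y v, agree x v, agree z v & agree s v]) /
     Pr f (fun v => [&& agree x v, agree z v & agree s v])) *
    (Pr f (fun v => agree s v && agree z v) / Pr f (fun v => agree z v)).
Proof.
move=> fdo f zdo_gt0 z_gt0 sP.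
have [v0 zv0] := Pr_gt0_ex z_gt0.
have obs0 P : Pr f P = Pr (obs_density (perturb 0)) P.
  by apply: eq_Pr => // v; rewrite obs_perturb0.
have do0 P : Pr fdo P = Pr (do_density (perturb 0) x) P.
  by apply: eq_Pr => // v; rewrite do_perturb0.
have [a aE] := polyfun_do x (fun v => agree y v && agree z v).
have [b bE] := polyfun_do x (fun v => agree z v).
have [h hE] := polyfun_obs (fun v => agree z v).
have [c cE] := fin_all_exists (fun s : asg T S =>
  polyfun_obs (fun v => [&& agree y v, agree x v, agree z v & agree s v])).
have [d dE] := fin_all_exists (fun s : asg T S =>
  polyfun_obs (fun v => [&& agree x v, agree z v & agree s v])).
have [g gE] := fin_all_exists (fun s : asg T S =>
  polyfun_obs (fun v => agree s v && agree z v)).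
rewrite !obs0 !do0 aE bE hE.
under eq_bigr => s _ do rewrite !obs0 cE dE gE.
rewrite do0 bE in zdo_gt0; rewrite obs0 hE in z_gt0.
apply: ratio_sum_limit.
- by rewrite gt_eqF.
- by rewrite gt_eqF.
- move=> s; rewrite -dE -gE -!obs0.
  by case: (sP s) => [sx|->]; [left; rewrite gt_eqF | right].
- move=> s t t01; rewrite -cE -dE.
  have ge0 v : 0 <= obs_density (perturb t) v by apply/ltW/obs_perturb_gt0.
  by rewrite Pr_ge0 //= le_Pr // => v /andP[].
- move=> s t t01; rewrite -gE -hE.
  have ge0 v : 0 <= obs_density (perturb t) v by apply/ltW/obs_perturb_gt0.
  by rewrite divr_ge0 // Pr_ge0.
move=> t t01; rewrite -aE -bE -hE.
under eq_bigr => s _ do rewrite -cE -dE -gE.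
(* If [S] is empty there is a single stratum, of weight 1, so the sum formula covers this case
   too. *)
rewrite (adjS (perturb_causal t01)); case: eqP => // S0.
have agS (s : asg T S) v : agree s v by move: s; rewrite S0 => s; apply: agree_set0.
set f' := obs_density _; rewrite [RHS](eq_bigr (fun=>
    Pr f' (fun v => [&& agree y v, agree x v & agree z v]) /
    Pr f' (fun v => agree x v && agree z v))) => [|s _].
  by rewrite sumr_const (_ : #|_| = 1%N) // S0 card_asg_set0.
have agE (P P' : pred cfg) : P =1 P' -> Pr f' P = Pr f' P' by apply: eq_Pr.
rewrite (agE _ (fun v => [&& agree y v, agree x v & agree z v])); last first.
  by move=> v; rewrite agS andbT.
rewrite (agE (fun v => [&& agree x v, _ v & _ v]) (fun v => agree x v && agree z v)); last first.
  by move=> v; rewrite agS andbT.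
rewrite (agE (fun v => agree s v && _ v) (fun v => agree z v)); last first.
  by move=> v; rewrite agS.
by rewrite divff ?mulr1 // gt_eqF // (Pr_gt0 (v := v0)) // => v; apply: obs_perturb_gt0.
Qed.

End PositiveApproximation.

(** * Adjustment as counting of noise assignments *)

Section MechanismAdjustment.
Local Open Scope ring_scope.
Variables (R : realType) (V : finType) (E : rel V) (X Y Z S : {set V}).
Hypotheses (dagE : dag E) (adjS : cond_adjustment_set R E X Y Z S).
Variables (T N : finType) (t0 : T) (F : V -> {ffun V -> T} -> N -> T).
Hypotheses (locF : local_mech E F) (N_gt0 : (0 < #|N|)%N).
Notation cfg := {ffun V -> T}.

(** An intervention makes the equations of [X] constant; their kernels are point masses, which yield
    the indicator in [do_density]. *)
Definition do_mech (x : asg T X) i (v : cfg) n :=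
  if insub i is Some j then x j else F i v n.

Lemma do_mech_local x : local_mech E (do_mech x).
Proof. by move=> i v w n vw; rewrite /do_mech; case: insubP => // _; apply: locF. Qed.

Lemma do_mech_kernel x i v t : mech_kernel R (do_mech x) i v t =
  if insub i is Some j then (t == x j)%:R else mech_kernel R F i v t.
Proof.
rewrite /mech_kernel /do_mech; case: insubP => // j _ _.
rewrite eq_sym; case: eqP => _.
  by rewrite (eq_card (B := N)) ?divff ?pnatr_eq0 -?lt0n // => n; rewrite inE.
by rewrite (eq_card0 (A := [set _ | _])) ?mul0r // => n; rewrite inE.
Qed.

Lemma do_density_mech x v :
  do_density (mech_kernel R F) x v = \prod_i mech_kernel R (do_mech x) i v (v i).
Proof.
rewrite /do_density [RHS](bigID (fun i => i \in X)) /= mulrC; congr (_ * _); last first.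
  by apply: eq_bigr => i; rewrite do_mech_kernel; case: insubP => // j ->.
have [/forallP xv|/forallPn[i xi]] := boolP (agree x v).
  rewrite big1 // => i Xi; rewrite do_mech_kernel insubT /=.
  by have := xv (Sub i Xi) => /= ->.
rewrite (bigD1 (val i)) ?(valP i) //= do_mech_kernel valK (negbTE xi) mul0r.
by [].
Qed.

Let sol := solve t0 F.
Let solx x := solve t0 (do_mech x).

Let M : R := (#|N| ^ #|V|)%:R.

Lemma Pr_do_mech x P : Pr (do_density (mech_kernel R F) x) P = #|[set u | P (solx x u)]|%:R / M.
Proof.
by rewrite -(Pr_mech dagE) //; [apply: eq_Pr => // v; apply: do_density_mech | exact: do_mech_local].
Qed.

Lemma Pr_obs_mech P : Pr (obs_density (mech_kernel R F)) P = #|[set u | P (sol u)]|%:R / M.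
Proof. by rewrite -(Pr_mech dagE). Qed.

Let M_neq0 : M != 0.
Proof. by rewrite pnatr_eq0 -lt0n expn_gt0 N_gt0. Qed.

Let M_ratio (a b : R) : (a / M) / (b / M) = a / b.
Proof. by rewrite invfM invrK mulrACA mulVf ?mulr1 ?M_neq0. Qed.

(** The identity is summed over the values [y] satisfying [Q]. The sum over strata becomes a sum
    over noise [u']: a stratum occurs once per [u'] producing it, which supplies its weight. *)
Lemma mech_adjustment (x : asg T X) (z : asg T Z) (Q : pred cfg) :
  (forall v w : cfg, {in Y, v =1 w} -> Q v = Q w) ->
  (exists u, agree z (solx x u)) -> (exists u, agree z (sol u)) ->
  (forall u', agree z (sol u') -> exists u,
     [&& agree x (sol u), agree z (sol u) & [forall i in S, sol u i == sol u' i]]) ->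
  #|[set u | Q (solx x u) && agree z (solx x u)]|%:R / #|[set u | agree z (solx x u)]|%:R =
  (\sum_(u' | agree z (sol u'))
     #|[set u | [&& Q (sol u), agree x (sol u), agree z (sol u) &
                    [forall i in S, sol u i == sol u' i]]]|%:R
   / #|[set u | [&& agree x (sol u), agree z (sol u) &
                    [forall i in S, sol u i == sol u' i]]]|%:R)
  / #|[set u | agree z (sol u)]|%:R :> R.
Proof.
move=> QY [ux uxP] [uz uzP] xS.
have M_gt0 : 0 < M by rewrite lt0r M_neq0 ler0n.
have [Q' QE] : exists Q' : pred (asg T Y), forall v, Q v = Q' (restr Y v).
  exists [pred y | [exists v, agree y v && Q v]] => v.
  apply/idP/existsP => [Qv|[w /andP[]]]; first by exists v; rewrite agreeE eqxx.
  by rewrite agreeE => /restr_eqP /QY ->.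
have eqSE u u' : [forall i in S, sol u i == sol u' i] = agree (restr S (sol u')) (sol u).
  rewrite agreeE eq_sym; apply/forall_inP/restr_eqP => [uu i /uu/eqP//|uu i /uu->//].
have cnt_gt0 (P : pred {ffun V -> N}) u : P u -> 0 < #|[set u | P u]|%:R / M.
  by move=> Pu; rewrite divr_gt0 // ltr0n; apply/card_gt0P; exists u; rewrite inE.
have main (y : asg T Y) := @cond_adjustment_limit R V E X Y Z S adjS T (mech_kernel R F)
  (fun i v w => @mech_kernel_local V E T N R F i v w locF) (@mech_kernel_ge0 V T N R F)
  (@mech_kernel_sum1 V T N R N_gt0 F) x y z.
pose fdo := do_density (mech_kernel R F) x; pose f := obs_density (mech_kernel R F).
have {}main : \sum_(y | Q' y)
    Pr fdo (fun v => agree y v && agree z v) / Pr fdo (fun v => agree z v) =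
  \sum_(y | Q' y) \sum_(s : asg T S)
    (Pr f (fun v => [&& agree y v, agree x v, agree z v & agree s v]) /
     Pr f (fun v => [&& agree x v, agree z v & agree s v])) *
    (Pr f (fun v => agree s v && agree z v) / Pr f (fun v => agree z v)).
  apply: eq_bigr => y _; apply: main.
  - by rewrite Pr_do_mech; apply: cnt_gt0 uxP.
  - by rewrite Pr_obs_mech; apply: cnt_gt0 uzP.
  move=> s; rewrite !Pr_obs_mech.
  have [->|[u']] := set_0Vmem [set u | agree s (sol u) && agree z (sol u)].
    by right; rewrite cards0 mul0r.
  rewrite inE => /andP[su' zu']; left; have [u uP] := xS u' zu'; apply: (cnt_gt0 _ u).
  by move: uP; rewrite eqSE; move: su'; rewrite agreeE => /eqP->.
rewrite -mulr_suml -(Pr_restr _ Q') exchange_big /= in main.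
move: main; under eq_bigr => s _ do rewrite -!mulr_suml -(Pr_restr _ Q').
rewrite /fdo /f !Pr_do_mech M_ratio.
rewrite (eq_card (B := [set u | Q (solx x u) && agree z (solx x u)])); last by move=> u; rewrite !inE -QE.
move=> ->; rewrite [RHS]mulr_suml.
rewrite [RHS](partition_big (fun u => restr S (sol u)) predT) //=; apply: eq_bigr => s _.
rewrite !Pr_obs_mech !M_ratio mulrA.
rewrite [RHS](eq_bigr (fun=>
  #|[set u | [&& Q (sol u), agree x (sol u), agree z (sol u) & agree s (sol u)]]|%:R /
  #|[set u | [&& agree x (sol u), agree z (sol u) & agree s (sol u)]]|%:R /
  #|[set u | agree z (sol u)]|%:R)); last first.
  move=> u' /andP[_ /eqP sE]; congr (_%:R / _%:R / _); apply: eq_card => u; rewrite !inE eqSE sE //.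
rewrite sumr_const -[RHS]mulr_natr [RHS]mulrAC; congr (_%:R / _%:R * _%:R / _).
  by apply: eq_card => u; rewrite !inE -QE.
by apply: eq_card => u; rewrite !inE agreeE eq_sym andbC.
Qed.

(** The form used by the models: events are predicates on noise, and that of [z] is the same with
    and without intervention, so its probability cancels. *)
Lemma mech_adjustment_count (x : asg T X) (z : asg T Z) (Q : pred cfg)
    (qx q xo zo : pred {ffun V -> N}) (e : rel {ffun V -> N}) :
  (forall v w : cfg, {in Y, v =1 w} -> Q v = Q w) ->
  (forall u, Q (solx x u) = qx u) -> (forall u, agree z (solx x u) = zo u) ->
  (forall u, Q (sol u) = q u) -> (forall u, agree x (sol u) = xo u) ->
  (forall u, agree z (sol u) = zo u) ->
  (forall u u', zo u -> zo u' -> [forall i in S, sol u i == sol u' i] = e u u') ->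
  (exists u, zo u) -> (forall u', zo u' -> exists u, [&& xo u, zo u & e u u']) ->
  #|[set u | qx u && zo u]|%:R =
    \sum_(u' | zo u') #|[set u | [&& q u, xo u, zo u & e u u']]|%:R
                     / #|[set u | [&& xo u, zo u & e u u']]|%:R :> R.
Proof.
move=> QY qxE zxE qE xE zE eE [u0 zu0] xP.
have := @mech_adjustment x z Q QY; rewrite (eq_card (B := [set u | qx u && zo u])); last first.
  by move=> u; rewrite !inE qxE zxE.
have zc_neq0 : #|[set u | zo u]|%:R != 0 :> R.
  by rewrite pnatr_eq0 -lt0n; apply/card_gt0P; exists u0; rewrite inE.
rewrite (eq_card (A := [set u | agree z (solx x u)]) (B := [set u | zo u])); last first.
  by move=> u; rewrite !inE zxE.
rewrite (eq_card (A := [set u | agree z (sol u)]) (B := [set u | zo u])); last first.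
  by move=> u; rewrite !inE zE.
move=> main; apply: (mulIf (invr_neq0 zc_neq0)); rewrite main.
- congr (_ / _); apply: eq_big => u'; rewrite zE // => zu'.
  congr (_%:R / _%:R); apply: eq_card => u; rewrite !inE.
    by rewrite qE xE zE; case: (boolP (zo u)) => zu; rewrite ?andbF ?eE.
  by rewrite xE zE; case: (boolP (zo u)) => zu; rewrite ?andbF ?eE.
- by exists u0; rewrite zxE.
- by exists u0; rewrite zE.
move=> u' zu'; rewrite zE in zu'; have [u /and3P[xu zu eu]] := xP u' zu'.
by exists u; rewrite xE zE xu zu eE.
Qed.

End MechanismAdjustment.

(** * Broadcast models *)

Section Avoiding.
Variables (V : finType) (E : rel V).

(* [reach B a b]: a directed path from [a] to [b] avoiding [B], except possibly
   at its start [a]. *)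
Definition avoid (B : {set V}) (a b : V) := E a b && (b \notin B).
Definition reach B := connect (avoid B).

Lemma reach_last B a b : reach B a b -> b != a -> exists2 p, reach B a p & E p b && (b \notin B).
Proof.
move=> /connectP[s + ->]; elim/last_ind: s => [|s c _]; first by rewrite eqxx.
rewrite rcons_path last_rcons => /andP[ps pc] _; exists (last a s) => //.
by apply/connectP; exists s.
Qed.

Lemma reach_notin B a b : reach B a b -> b \in B -> b = a.
Proof.
move=> ab bB; apply: contraTeq bB => /(reach_last ab)[p _ /andP[]//].
Qed.

Lemma reach_connect B a b : reach B a b -> connect E a b.
Proof. by apply: connect_sub => c d /andP[cd _]; apply: connect1. Qed.

End Avoiding.

Section Broadcast.
Variables (V : finType) (E : rel V) (K N : finType).
Hypothesis dagE : dag E.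
Notation cfg := {ffun V -> {ffun K -> option bool}}.
(* A node holds one optional bit per signal: signal [s] originates at [r s] with
   value [orig s], is copied along all directed paths that avoid [Bl s], and
   reads [None] elsewhere. *)
Variables (r : K -> V) (Bl : K -> {set V}) (orig : K -> cfg -> N -> option bool).
Hypothesis orig_local : forall s (v w : cfg) n,
  (forall j, E j (r s) -> v j = w j) -> orig s v n = orig s w n.

Definition carries s i := reach E (Bl s) (r s) i.

(** Any carrying parent will do, since all of them hold the same value. *)
Definition carrier_parent s i := odflt i [pick j | E j i && carries s j].

Lemma carrier_parentP s i : carries s i -> i != r s ->
  E (carrier_parent s i) i && carries s (carrier_parent s i).
Proof.
rewrite /carrier_parent => ci ir; case: pickP => // nop.
by have [p cp /andP[Epi _]] := reach_last ci ir; have := nop p; rewrite Epi /carries cp.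
Qed.

Definition broadcast i (v : cfg) (n : N) : {ffun K -> option bool} :=
  [ffun s => if i == r s then orig s v n
             else if carries s i then v (carrier_parent s i) s else None].

Lemma broadcast_local : local_mech E broadcast.
Proof.
move=> i v w n vw; apply/ffunP => s; rewrite !ffunE.
case: (eqVneq i (r s)) => [ir|ir]; first by apply: orig_local; rewrite -ir.
by case: ifP => // ci; rewrite vw //; case/andP: (carrier_parentP ci ir).
Qed.

Section Solution.
Variables (D : {set V}) (u : {ffun V -> N}) (v : cfg).
Hypothesis vE : forall i, i \notin D -> v i = broadcast i v (u i).

(** [D] is the set of nodes under intervention. As [Bl s] contains it, a signal meets [D] at most at
    its origin and is copied by the equations everywhere else. *)
Lemma broadcast_carried s i : D \subset Bl s -> carries s i -> v i s = v (r s) s.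
Proof.
move=> sDB; elim/(dag_ind dagE): i => i IH ci.
have [->//|ir] := eqVneq i (r s).
have iD : i \notin D.
  by have [p _ /andP[_ iB]] := reach_last ci ir; apply: contra iB; apply: (subsetP sDB).
have /andP[Ep cp] := carrier_parentP ci ir.
by rewrite vE // ffunE (negbTE ir) ci IH.
Qed.

Lemma broadcast_idle s i : i \notin D -> ~~ carries s i -> v i s = None.
Proof.
move=> iD nci; rewrite vE // ffunE (negbTE nci) ifN //.
by apply: contraNneq nci => ->; apply: connect0.
Qed.

Lemma broadcast_origin s : r s \notin D -> v (r s) s = orig s v (u (r s)).
Proof. by move=> rD; rewrite vE // ffunE eqxx. Qed.

End Solution.

Lemma solve_do_broadcast t0 (X : {set V}) (x : asg _ X) u i :
  i \notin X -> solve t0 (do_mech broadcast x) u i = broadcast i (solve t0 (do_mech broadcast x) u) (u i).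
Proof.
move=> iX; rewrite [LHS](solveE dagE) ?{1}/do_mech ?insubN //.
by apply: do_mech_local; apply: broadcast_local.
Qed.

Lemma solve_do_broadcastX t0 (X : {set V}) (x : asg _ X) u (i : {i | i \in X}) :
  solve t0 (do_mech broadcast x) u (val i) = x i.
Proof.
rewrite (solveE dagE) /do_mech ?valK //.
by apply: do_mech_local; apply: broadcast_local.
Qed.

End Broadcast.

(** * The mediator model *)

Section MediatorModel.
Variables (R : realType) (V : finType) (E : rel V) (X Y Z S : {set V}).
Hypotheses (dagE : dag E) (adjS : cond_adjustment_set R E X Y Z S).
Hypotheses (disXZ : [disjoint X & Z]) (disXS : [disjoint X & S]) (ZDe : Z :&: De E X = set0).
Let O := X :|: (S :|: Z).

Lemma descendant_notin_Z x i : x \in X -> connect E x i -> i \notin Z.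
Proof.
move=> xX xi; apply: contra_eqN ZDe => iZ; apply/set0Pn; exists i.
by rewrite inE iZ inE; apply/exists_inP; exists x.
Qed.

Variables (x0 p m y0 s0 : V).
Hypotheses (x0X : x0 \in X) (x0p : reach E O x0 p) (Epm : E p m) (mX : m \notin X).
Hypotheses (y0Y : y0 \in Y) (my0 : reach E X m y0) (s0S : s0 \in S) (ms0 : reach E X m s0).

Let r (s : bool) := if s then x0 else m.
(** Blocking at [O] hides the value of [x0] from [S]; blocking only at [X] lets the value of [m]
    reach both [y0] and [s0]. *)
Let Bl (s : bool) := if s then O else X.
Let orig (s : bool) (v : {ffun V -> {ffun bool -> option bool}}) (n : bool) : option bool :=
  if s then Some n else Some ((v p true == Some true) && n).
Let F := broadcast E r Bl orig.

Let orig_local s (v w : {ffun V -> {ffun bool -> option bool}}) n :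
  (forall j, E j (r s) -> v j = w j) -> orig s v n = orig s w n.
Proof. by case: s => //= vw; rewrite /orig vw. Qed.

Let locF : local_mech E F.
Proof. exact: broadcast_local orig_local. Qed.

Let t0 : {ffun bool -> option bool} := [ffun=> None].
(** Nodes of [X] other than [x0] carry no signal, so they can only hold [None]. *)
Let x : asg {ffun bool -> option bool} X :=
  [ffun i => [ffun s => if (val i == x0) && s then Some true else None]].
Let z : asg {ffun bool -> option bool} Z := [ffun=> t0].

Let sXBl s : X \subset Bl s.
Proof. by case: s => //; apply: subsetUl. Qed.

Let carriesXN s i : carries E r Bl s i -> i \in X -> i = r s.
Proof. by move=> ci iX; apply: reach_notin ci _; apply: subsetP (sXBl s) _ iX. Qed.

Let carriesON i : carries E r Bl true i -> i \in O -> i = x0.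
Proof. by move=> ci iX; apply: reach_notin ci _. Qed.

Let carriesZN s i : i \in Z -> ~~ carries E r Bl s i.
Proof.
apply: contraTN => ci; apply: (descendant_notin_Z x0X).
have := reach_connect ci; case: s {ci} => //=; apply: connect_trans.
exact: connect_trans (reach_connect x0p) (connect1 Epm).
Qed.

Let sol := solve t0 F.
Let solx := solve t0 (do_mech F x).

Let solE u i : i \notin (set0 : {set V}) -> sol u i = F i (sol u) (u i).
Proof. by move=> _; apply: (solveE dagE). Qed.

Let solxE u i : i \notin X -> solx u i = F i (solx u) (u i).
Proof. exact: solve_do_broadcast. Qed.

Let solx_x0 u : solx u x0 true = Some true.
Proof.
have solxX : solx u (val (Sub x0 x0X : {i | i \in X})) = x (Sub x0 x0X).
  exact: solve_do_broadcastX.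
by rewrite /= in solxX; rewrite solxX !ffunE /= eqxx.
Qed.

Let sol_xs u i : carries E r Bl true i -> sol u i true = Some (u x0).
Proof.
move=> ci; rewrite (broadcast_carried dagE (solE u) (sub0set _) ci).
by rewrite (broadcast_origin (solE u)) ?inE.
Qed.

Let sol_m u i : carries E r Bl false i -> sol u i false = Some (u x0 && u m).
Proof.
move=> ci; rewrite (broadcast_carried dagE (solE u) (sub0set _) ci).
rewrite (broadcast_origin (solE u)) ?inE // /orig /= (sol_xs _ x0p).
by case: (u x0).
Qed.

Let solx_m u i : carries E r Bl false i -> solx u i false = Some (u m).
Proof.
move=> ci; rewrite (broadcast_carried dagE (solxE u) (sXBl _) ci).
rewrite (broadcast_origin (solxE u)) // /orig.
by rewrite (broadcast_carried dagE (solxE u) (sXBl true) x0p) solx_x0.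
Qed.

(** With [x0] set to true, [y0] sees true with probability 1/2. A stratum reveals the value of [m],
    so adjusting yields the observational probability of that value being true, 1/4. *)
Lemma mediator_model_contradiction : False.
Proof.
have N_gt0 : (0 < #|{: bool}|)%N by rewrite card_bool.
pose Q (v : {ffun V -> {ffun bool -> option bool}}) := v y0 false == Some true.
have zP (v : {ffun V -> {ffun bool -> option bool}}) : (forall i s, i \in Z -> v i s = None) -> agree z v.
  by move=> vz; apply/forallP => i; apply/eqP/ffunP => s; rewrite !ffunE vz ?(valP i).
refine ((_ : _ -> False) (@mech_adjustment_count R V E X Y Z S dagE adjS _ _ t0 F locF N_gt0 x z Q
  (fun u => u m) (fun u => u x0 && u m) (fun u => u x0) predT
  (fun u u' => (u x0 && u m) == (u' x0 && u' m)) _ _ _ _ _ _ _ _ _)).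
- apply/eqP; rewrite gt_eqF //.
  (* Every term is 0 or 1, since within a stratum the bit at [y0] is the one reported at [s0]. *)
  rewrite (eq_bigr (fun u' : {ffun V -> bool} => (u' x0 && u' m)%:R%R)) => [|u' _].
    rewrite -natr_sum ltr_nat -big_mkcond /= sum1dep_card; apply: proper_card.
    apply/properP; split; first by apply/subsetP => u; rewrite !inE => /andP[_ ->].
    (* Here the noise of [m] is on and [x0] is off, so only the interventional count includes it. *)
    exists [ffun i => i == m]; rewrite !inE !ffunE ?eqxx //=.
    by rewrite andbT; apply: (contraNneq _ mX) => <-.
  rewrite [RHS](_ : _ = (if u' x0 && u' m then 1%R else 0%R)); last by case: ifP.
  case: ifP => [u'1|u'0].
    rewrite (eq_card (B := [set u : {ffun V -> bool} |
      [&& u x0, predT u & (u x0 && u m) == true]])) ?divff //.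
      rewrite pnatr_eq0 -lt0n; apply/card_gt0P; exists u'; rewrite !inE.
      by case/andP: u'1 => -> ->.
    by move=> u; rewrite !inE; case: (u x0); case: (u m).
  rewrite (eq_card0 (A := [set u : {ffun V -> bool} | [&& u x0 && u m, _ & _]])) ?mul0r // => u.
  by rewrite !inE; case: (u x0); case: (u m).
- by move=> v w vw; rewrite /Q vw.
- by move=> u; rewrite /Q solx_m //; case: (u m).
- move=> u; apply: zP => i s iZ; rewrite (broadcast_idle (solxE u)) ?carriesZN //.
  by rewrite (disjointFl disXZ).
- by move=> u; rewrite /Q sol_m //; case: (_ && _).
- move=> u; apply/forallP/idP => [/(_ (Sub x0 x0X))|ux i].
    move=> /eqP/ffunP/(_ true); rewrite /= !ffunE /= eqxx sol_xs //; last exact: connect0.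
    by case.
  apply/eqP/ffunP => s; rewrite !ffunE; have [ci|nci] := boolP (carries E r Bl s (val i)).
    have := carriesXN ci (valP i); case: s ci => /= ci iE; last by move: mX; rewrite -iE (valP i).
    by rewrite iE eqxx sol_xs ?ux //; apply: connect0.
  rewrite (broadcast_idle (solE u)) ?inE //; case: eqP => //= ix; case: s nci => //.
  by move: ix => /= -> /negP[]; apply: connect0.
- move=> u; apply: zP => i s iZ; by rewrite (broadcast_idle (solE u)) ?inE ?carriesZN.
- move=> u u' _ _; apply/forall_inP/eqP => [/(_ s0 s0S)/eqP/ffunP/(_ false)|uu i iS].
    by rewrite !sol_m // => -[].
  apply/eqP/ffunP => s; have [ci|nci] := boolP (carries E r Bl s i); last first.
    by rewrite (broadcast_idle (solE u)) ?(broadcast_idle (solE u')) ?inE.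
  case: s ci => ci; last by rewrite !sol_m // uu.
  have iE : i = x0 by apply: carriesON => //; rewrite !inE iS orbT.
  by move: x0X; rewrite -iE (disjointFl disXS).
- by exists [ffun=> true].
(* Turn [x0] on and let the noise of [m] reproduce the value that [m] takes under [u']. *)
- move=> u' _; exists [ffun i => if i == m then u' x0 && u' m else true].
  have x0m : x0 != m by apply: (contraNneq _ mX) => <-.
  by rewrite !ffunE (negbTE x0m) eqxx /= eqxx.
Qed.

End MediatorModel.

(** * Counting within an ambiguous class *)

Section ClassCount.
Variables (R : realType) (Om : finType) (C : eqType) (f : Om -> C) (q x z : pred Om) (c : C).

(* Outside the class [c] the value of [f] determines [q], so the identity forces
   [q] and [x] to be independent within that class. *)
Lemma class_count :
  (#|[set u | q u && z u]|%:R = \sum_(u' | z u')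
     #|[set u | [&& q u, x u, z u & f u == f u']]|%:R /
     #|[set u | [&& x u, z u & f u == f u']]|%:R :> R)%R ->
  (forall u', z u' -> exists u, [&& x u, z u & f u == f u']) ->
  (forall u u', f u' != c -> f u = f u' -> q u = q u') ->
  (forall u, f u = c -> z u) ->
  #|[set u | f u == c]| * #|[set u | (f u == c) && (q u && x u)]| =
  #|[set u | (f u == c) && q u]| * #|[set u | (f u == c) && x u]|.
Proof.
move=> sumE xP qP cz.
have [c0|[u0]] := set_0Vmem [set u | f u == c].
  rewrite c0 cards0 (_ : #|[set u | (f u == c) && q u]| = 0) //.
  by apply: eq_card0 => u; move/setP/(_ u): c0; rewrite !inE => ->.
rewrite inE => /eqP u0c; have zu0 := cz _ u0c.
have xc_gt0 : 0 < #|[set u | (f u == c) && x u]|.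
  have [u /and3P[xu zu /eqP fu]] := xP _ zu0.
  by apply/card_gt0P; exists u; rewrite inE xu fu u0c eqxx.
have xc_neq0 : (#|[set u | (f u == c) && x u]|%:R != 0 :> R)%R by rewrite pnatr_eq0 -lt0n.
(* Terms inside the class share one ratio; outside, each is the indicator of [q] and cancels against
   the matching part of the left side. *)
move: sumE; rewrite (bigID (fun u => f u == c)) /=.
under eq_bigr => u' /andP[zu' /eqP fu'].
  rewrite (eq_card (B := [set u | (f u == c) && (q u && x u)])); last first.
    move=> u; rewrite !inE fu' [in RHS]andbC -!andbA; do 2!congr (_ && _).
    by case: (eqVneq (f u) c) => [/cz->|]; rewrite ?andbF.
  rewrite [X in (_ / X%:R)%R](eq_card (B := [set u | (f u == c) && x u])); last first.
    move=> u; rewrite !inE fu' [in RHS]andbC; congr (_ && _).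
    by case: (eqVneq (f u) c) => [/cz->|]; rewrite ?andbF.
  over.
under [X in (_ = _ + X)%R]eq_bigr => u' /andP[zu' fu'].
  rewrite (_ : (_ / _ = (q u')%:R)%R); first over.
  have [u1 u1P] := xP _ zu'.
  have x_neq0 : (#|[set u | [&& x u, z u & f u == f u']]|%:R != 0 :> R)%R.
    by rewrite pnatr_eq0 -lt0n; apply/card_gt0P; exists u1; rewrite inE.
  have [qu'|nqu'] := boolP (q u').
    rewrite (eq_card (B := [set u | [&& x u, z u & f u == f u']])) ?divff // => u.
    rewrite !inE; have [fE|] := eqVneq (f u) (f u'); last by rewrite !andbF.
    by rewrite (qP u u' fu' fE) qu'.
  rewrite (eq_card0 (A := [set u | [&& q u, _ u, _ u & _]])) ?mul0r // => u; rewrite !inE.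
  have [fE|] := eqVneq (f u) (f u'); last by rewrite !andbF.
  by rewrite (qP u u' fu' fE) (negbTE nqu').
rewrite sumr_const -natr_sum -big_mkcondr /= sum1dep_card.
have -> : #|[set u | q u && z u]| =
    (#|[set u | (f u == c) && q u]| + #|[set u | (z u && (f u != c)) && q u]|)%N.
  rewrite -(cardsID [set u | f u == c] [set u | _ && z u]); congr (_ + _); apply: eq_card => u.
    by rewrite !inE; case: (eqVneq (f u) c) => [/cz->|]; rewrite ?andbF ?andbT.
  by rewrite !inE; case: (q u); rewrite ?andbF ?andbT // andbC.
rewrite natrD => /addIr /(congr1 (fun a => a * #|[set u | (f u == c) && x u]|%:R)%R).
rewrite -[(_ / _ *+ _)%R]mulr_natr [RHS]mulrAC mulfVK // -!natrM => /eqP; rewrite eqr_nat => /eqP ->.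
rewrite mulnC; congr (_ * _); apply: eq_card => u; rewrite !inE.
by rewrite unfold_in; case: (eqVneq (f u) c) => [/cz->|]; rewrite ?andbF ?andbT.
Qed.

(** Independence as the vanishing determinant of a 2 by 2 table, whose entries can be compared by
    injections. *)
Lemma class_cross :
  #|[set u | f u == c]| * #|[set u | (f u == c) && (q u && x u)]| =
  #|[set u | (f u == c) && q u]| * #|[set u | (f u == c) && x u]| ->
  #|[set u | [&& f u == c, q u & x u]]| * #|[set u | [&& f u == c, ~~ q u & ~~ x u]]| =
  #|[set u | [&& f u == c, q u & ~~ x u]]| * #|[set u | [&& f u == c, ~~ q u & x u]]|.
Proof.
set a := #|[set u | (f u == c) && (q u && x u)]|.
set b' := #|[set u | [&& f u == c, ~~ q u & ~~ x u]]|.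
set a' := #|[set u | [&& f u == c, q u & ~~ x u]]|.
set b := #|[set u | [&& f u == c, ~~ q u & x u]]|.
have splitE (P Q : pred Om) : #|[set u | P u]| = #|[set u | P u && Q u]| + #|[set u | P u && ~~ Q u]|.
  rewrite -(cardsID [set u | Q u]); congr (_ + _); apply: eq_card => u; rewrite !inE //.
  by rewrite andbC.
have qE : #|[set u | (f u == c) && q u]| = a + a'.
  rewrite (splitE _ x); congr (_ + _); apply: eq_card => u; by rewrite !inE -andbA.
have nqE : #|[set u | (f u == c) && ~~ q u]| = b + b'.
  rewrite (splitE _ x); congr (_ + _); apply: eq_card => u; by rewrite !inE -andbA.
have xE : #|[set u | (f u == c) && x u]| = a + b.
  rewrite (splitE _ q); congr (_ + _); apply: eq_card => u; rewrite !inE -andbA //.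
    by congr (_ && _); rewrite andbC.
  by congr (_ && _); rewrite andbC.
rewrite (splitE _ q) qE nqE xE => /eqP.
(* The added terms complete the two sides to those of [main]. *)
move/eqP=> main; apply/eqP; rewrite -(eqn_add2l (a * a + a' * a + b * a)).
apply/eqP; nia.
Qed.

End ClassCount.

Lemma ord_chain_const (T : Type) k (g : 'I_k.+1 -> T) :
  (forall j : 'I_k, g (widen_ord (leqnSn k) j) = g (lift ord0 j)) ->
  forall j, g j = g ord0.
Proof.
move=> gE [m lt_m]; elim: m lt_m => [|m IHm] lt_m; first by congr g; apply: val_inj.
rewrite -(IHm (ltnW lt_m)) -[RHS](_ : g (widen_ord (leqnSn k) (Ordinal (lt_m : m < k))) = _).
  by rewrite gE; congr g; apply: val_inj.
by congr g; apply: val_inj.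
Qed.

(** * The chain model *)

Section ChainModel.
Variables (R : realType) (V : finType) (E : rel V) (X Y Z S : {set V}).
Hypotheses (dagE : dag E) (adjS : cond_adjustment_set R E X Y Z S).
Hypotheses (disXZ : [disjoint X & Z]) (disXS : [disjoint X & S]) (ZDe : Z :&: De E X = set0).
Let O := X :|: (S :|: Z).

Variables (k : nat) (rr : 'I_k.+1 -> V) (cc pl ph : 'I_k -> V).
(* [mode] distinguishes x -> c0 <- r_0 ([true]) from r_0 -> x = c0 ([false]). The
   index [j : 'I_k] numbers the collider between the forks [j] and [j + 1]. *)
Variables (mode : bool) (x0 c0 px pw y0 : V).
Let lo (j : 'I_k) := widen_ord (leqnSn k) j.
Let hi (j : 'I_k) := lift ord0 j.
Hypotheses (rrO : forall j, rr j \notin O) (ccX : forall j, cc j \notin X).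
Hypotheses (plR : forall j, reach E O (rr (lo j)) (pl j)) (plE : forall j, E (pl j) (cc j)).
Hypotheses (phR : forall j, reach E O (rr (hi j)) (ph j)) (phE : forall j, E (ph j) (cc j)).
Hypothesis ccobs : forall j, exists2 o, o \in S :|: Z & reach E X (cc j) o.
Hypotheses (y0Y : y0 \in Y) (y0R : reach E O (rr ord_max) y0).
Hypotheses (x0X : x0 \in X) (pwR : reach E O (rr ord0) pw) (pwE : E pw c0).
Hypothesis modeP : if mode
  then [/\ c0 \notin X, reach E O x0 px, E px c0 & exists2 o, o \in S :|: Z & reach E X c0 o]
  else c0 = x0.

(* Signals: the bit of each fork, the report of each collider, the value of x0,
   and the report of c0 (constantly [None] if [mode] is [false]). *)
Let K := (('I_k.+1 + 'I_k) + bool)%type.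
Let N := {ffun K -> bool}.
Let T := {ffun K -> option bool}.
Let cfg := {ffun V -> T}.
Let W j : K := inl (inl j).
Let C j : K := inl (inr j).
Let xs : K := inr true.
Let es : K := inr false.
Let r (s : K) := match s with
  | inl (inl j) => rr j | inl (inr j) => cc j | inr true => x0 | inr false => c0 end.
(** Bits and the value of [x0] stop at [O], so [S] and [Z] learn of them through reports only;
    reports stop at [X]. *)
Let Bl (s : K) := match s with
  | inl (inl _) | inr true => O | inl (inr _) | inr false => X end.
(** A disagreement is reported by the lower bit, which determines the other. The conjunctions make
    [x0] true less likely when fork 0 has bit true: outright if [mode] is false, given a false
    report of [c0] otherwise. *)
Let orig (s : K) (v : cfg) (n : N) : option bool := match s with
  | inl (inl j) => Some (n s)
  | inl (inr j) => let a := v (pl j) (W (lo j)) in if a == v (ph j) (W (hi j)) then None else a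
  | inr true => if mode then Some (n s) else Some (~~ ((v pw (W ord0) == Some true) && n es))
  | inr false => if mode then Some [&& v px xs == Some true, v pw (W ord0) == Some true & n s]
                 else None
  end.
Let F := broadcast E r Bl orig.

Let orig_local s (v w : cfg) n :
  (forall j, E j (r s) -> v j = w j) -> orig s v n = orig s w n.
Proof.
move: modeP; rewrite /orig; case: s => [[j|j]|[]] //= mP vw.
- by rewrite !vw.
- by case: ifP mP => // _ c0E; rewrite vw // -c0E.
- by case: ifP mP => // _ [_ _ ? _]; rewrite !vw.
Qed.

Let locF : local_mech E F.
Proof. exact: broadcast_local orig_local. Qed.

Let t0 : T := [ffun=> None].
Let x : asg T X := [ffun i => [ffun s => if (val i == x0) && (s == xs) then Some true else None]].
Let z : asg T Z := [ffun=> t0].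

Let sXBl s : X \subset Bl s.
Proof. by case: s => [[]|[]] //= *; apply: subsetUl. Qed.

Let carriesX s i : carries E r Bl s i -> i \in X -> i = r s.
Proof. by move=> ci iX; apply: reach_notin ci _; apply: subsetP (sXBl s) _ iX. Qed.

Let carriesW j i : i \in O -> ~~ carries E r Bl (W j) i.
Proof. by move=> iO; apply/negP => /reach_notin/(_ iO) ir; move: iO; rewrite ir (negbTE (rrO j)). Qed.

Let carriesxs i : i \in S :|: Z -> ~~ carries E r Bl xs i.
Proof.
move=> iSZ; apply/negP => /reach_notin; rewrite inE iSZ orbT => /(_ isT) /= ir.
by move: iSZ; rewrite ir inE (disjointFr disXZ) // (disjointFr disXS).
Qed.

Let carrieses i : i \in Z -> ~~ carries E r Bl es i.
Proof.
apply: contraTN => ci; apply: (descendant_notin_Z ZDe x0X).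
apply: connect_trans (reach_connect ci); move: modeP; case: ifP => /= [_ [_ x0p pc _]|_ ->//].
exact: connect_trans (reach_connect x0p) (connect1 pc).
Qed.

Let w (u : {ffun V -> N}) j := u (rr j) (W j).
Let kap (u : {ffun V -> N}) := u c0 es.
Let xi (u : {ffun V -> N}) := u x0 xs.
Let cv u j := if w u (lo j) == w u (hi j) then None else Some (w u (lo j)).
Let ev u := if mode then Some [&& xi u, w u ord0 & kap u] else None.
Let xbit u := if mode then xi u else ~~ (w u ord0 && kap u).
(** As [z] is [None] throughout, conditioning on it forces agreement at the colliders whose report
    reaches [Z]. *)
Let zok u := [forall j, [exists i in Z, carries E r Bl (C j) i] ==> (cv u j == None)].

Let sol := solve t0 F.
Let solx := solve t0 (do_mech F x).

Let solE u i : i \notin (set0 : {set V}) -> sol u i = F i (sol u) (u i).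
Proof. by move=> _; apply: (solveE dagE). Qed.

Let solxE u i : i \notin X -> solx u i = F i (solx u) (u i).
Proof. exact: solve_do_broadcast. Qed.

Section Values.
Variables (D : {set V}) (u : {ffun V -> N}) (v : cfg).
Hypothesis vE : forall i, i \notin D -> v i = F i v (u i).
Hypothesis sDX : D \subset X.

Let sDB s : D \subset Bl s.
Proof. exact: subset_trans (sXBl s). Qed.

(** Taking any [D] inside [X] serves both solutions: [D] is empty without intervention and [X] under
    it. *)
Lemma chain_model_W j i : carries E r Bl (W j) i -> v i (W j) = Some (w u j).
Proof.
move=> ci; rewrite (broadcast_carried dagE vE (sDB _) ci).
rewrite (broadcast_origin vE) //=; apply: contra (rrO j) => /(subsetP sDX) rX.
by rewrite inE rX.
Qed.

Lemma chain_model_C j i : carries E r Bl (C j) i -> v i (C j) = cv u j.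
Proof.
move=> ci; rewrite (broadcast_carried dagE vE (sDB _) ci).
rewrite (broadcast_origin vE) /=; last by apply: contra (ccX j) => /(subsetP sDX).
by rewrite (chain_model_W (plR j)) (chain_model_W (phR j)).
Qed.

Lemma chain_model_agree_z : agree z v = zok u.
Proof.
apply/forallP/forallP => [vz j|vz i].
  apply/implyP => /exists_inP[i iZ ci].
  have := vz (Sub i iZ) => /eqP/ffunP/(_ (C j)) /=.
  by rewrite !ffunE chain_model_C // => ->.
apply/eqP/ffunP => s; rewrite !ffunE; have iZ := valP i.
have iD : val i \notin D by apply/negP => /(subsetP sDX); rewrite (disjointFl disXZ).
have iSZ : val i \in S :|: Z by rewrite inE iZ orbT.
have [ci|nci] := boolP (carries E r Bl s (val i)); last by rewrite (broadcast_idle vE).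
case: s ci => [[j|j]|[]] ci.
- by move: ci; rewrite (negbTE (carriesW _ _)) // inE iSZ orbT.
- rewrite chain_model_C //; apply/eqP; move/implyP: (vz j); apply.
  by apply/exists_inP; exists (val i).
- by move: ci; rewrite (negbTE (carriesxs _)).
- by move: ci; rewrite (negbTE (carrieses _)).
Qed.

End Values.

Let sol_W u j i (ci : carries E r Bl (W j) i) := chain_model_W (solE u) (sub0set X) ci.
Let sol_C u j i (ci : carries E r Bl (C j) i) := chain_model_C (solE u) (sub0set X) ci.

Let sol_xs u i : carries E r Bl xs i -> sol u i xs = Some (xbit u).
Proof.
move=> ci; rewrite (broadcast_carried dagE (solE u) (sub0set _) ci).
rewrite (broadcast_origin (solE u)) ?inE //= /xbit; move: modeP; case: ifP => //= _ c0E.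
by rewrite (sol_W _ pwR) /kap c0E; case: (w u ord0).
Qed.

Let sol_es u i : carries E r Bl es i -> sol u i es = ev u.
Proof.
move=> ci; rewrite (broadcast_carried dagE (solE u) (sub0set _) ci).
rewrite (broadcast_origin (solE u)) ?inE //= /ev; move: modeP; case: ifP => //= mode1 [_ xp _ _].
rewrite (sol_W _ pwR) (sol_xs _ xp) /xbit mode1.
by case: (w u ord0); case: (xi u).
Qed.

Let code u := ([ffun j => cv u j], ev u).

(** Each collider report reaches [S], where it is compared, or [Z], where [zok] fixes it. A report
    of [c0] descends from [x0], so it must reach [S]. *)
Lemma chain_model_eqS u u' : zok u -> zok u' ->
  [forall i in S, sol u i == sol u' i] = (code u == code u').
Proof.
move=> zu zu'; apply/forall_inP/eqP => [uu|[/ffunP cE eE] i iS].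
  congr (_, _).
    apply/ffunP => j; rewrite !ffunE; have [o + co] := ccobs j.
    rewrite inE => /orP[/uu/eqP/ffunP/(_ (C j))|oZ]; first by rewrite !sol_C.
    have cZ : [exists i in Z, carries E r Bl (C j) i] by apply/exists_inP; exists o.
    move: zu zu' => /forallP/(_ j)/implyP/(_ cZ)/eqP -> /forallP/(_ j)/implyP/(_ cZ)/eqP ->.
    by [].
  move: modeP; case: ifP => mode1 mP; last by rewrite /ev mode1.
  case: mP => _ _ _ [o oSZ co]; move: oSZ; rewrite inE => /orP[/uu/eqP/ffunP/(_ es)|oZ].
    by rewrite !sol_es.
  by have := carrieses oZ; rewrite /carries co.
have iSZ : i \in S :|: Z by rewrite inE iS.
apply/eqP/ffunP => s; have [ci|nci] := boolP (carries E r Bl s i); last first.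
  by rewrite (broadcast_idle (solE u)) ?(broadcast_idle (solE u')) ?inE.
case: s ci => [[j|j]|[]] ci.
- by move: ci; rewrite (negbTE (carriesW _ _)) // inE iSZ orbT.
- by rewrite !sol_C //; have := cE j; rewrite !ffunE.
- by move: ci; rewrite (negbTE (carriesxs _)).
- by rewrite !sol_es.
Qed.

Lemma chain_model_agree_x u : agree x (sol u) = xbit u.
Proof.
apply/forallP/idP => [/(_ (Sub x0 x0X))|ux i].
  move=> /eqP/ffunP/(_ xs); rewrite /= !ffunE /= eqxx sol_xs //; last exact: connect0.
  by case.
apply/eqP/ffunP => s; rewrite !ffunE; have iX := valP i.
have [ci|nci] := boolP (carries E r Bl s (val i)); last first.
  rewrite (broadcast_idle (solE u)) ?inE //; case: eqP => //= ix; case: eqP => // sx.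
  by case/negP: nci; rewrite sx (_ : val i = x0) //; apply: connect0.
have ir := carriesX ci iX.
case: s ci ir => [[j|j]|[]] ci ir /=; rewrite ?andbF.
- by have := rrO j; rewrite inE negb_or -[rr j]ir iX.
- by have := ccX j; rewrite -[cc j]ir iX.
- by rewrite -[x0]ir eqxx sol_xs // ux.
- rewrite sol_es //; move: modeP; rewrite /ev; case: ifP => // _ [].
  by rewrite -[c0]ir iX.
Qed.

Let set_noise (a b : bool) (u : {ffun V -> N}) : {ffun V -> N} :=
  [ffun i => [ffun s => match s with inr true => a | inr false => b | _ => u i s end]].
(** Complementing every bit preserves agreement; this pairs noise with opposite values of the common
    bit. *)
Let flip (u : {ffun V -> N}) : {ffun V -> N} :=
  [ffun i => [ffun s => match s with inl (inl _) => ~~ u i s | _ => u i s end]].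
Let noise (a b c : bool) : {ffun V -> N} :=
  [ffun i => [ffun s => match s with inl _ => a | inr true => b | inr false => c end]].
(** The ambiguous class: every collider reports agreement and [c0], if it reports at all, reports
    false. *)
Let c := ([ffun j : 'I_k => None : option bool], if mode then Some false else None).
Let q u := w u ord_max.

Let set_noiseE a b u :
  [/\ w (set_noise a b u) =1 w u, xi (set_noise a b u) = a & kap (set_noise a b u) = b].
Proof. by split => [j||]; rewrite /w /xi /kap !ffunE. Qed.

Let flipE u : [/\ w (flip u) =1 (fun j => ~~ w u j), xi (flip u) = xi u & kap (flip u) = kap u].
Proof. by split => [j||]; rewrite /w /xi /kap !ffunE. Qed.

Let noiseE a b d : [/\ w (noise a b d) =1 (fun=> a), xi (noise a b d) = b & kap (noise a b d) = d].
Proof. by split => [j||]; rewrite /w /xi /kap !ffunE. Qed.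

Let flip_inj : injective flip.
Proof.
apply: (can_inj (g := flip)) => u; apply/ffunP => i; apply/ffunP => s; rewrite !ffunE.
by case: s => [[]|[]] // j; rewrite negbK.
Qed.

Let codeP u : (code u == c) = [forall j, w u j == w u ord0] && ~~ (mode && [&& xi u, w u ord0 & kap u]).
Proof.
have -> : (code u == c) = ((code u).1 == c.1) && ((code u).2 == c.2) by [].
congr (_ && _); last first.
  by rewrite /= /ev; case: ifP => //= _; case: [&& _, _ & _].
apply/eqP/forallP => [/ffunP cE j|wE].
  apply/eqP; apply: (ord_chain_const (g := w u)) => i; have := cE i; rewrite !ffunE /cv.
  by case: eqP.
by apply/ffunP => j; rewrite !ffunE /cv (eqP (wE (lo j))) (eqP (wE (hi j))) eqxx.
Qed.

(* Equal reports make the difference of the two bit vectors constant, so they are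
   equal or complementary; complementary ones can only report agreement. *)
Let cv_xor u u' : (forall j, cv u j = cv u' j) -> forall j, w u j (+) w u' j = w u ord0 (+) w u' ord0.
Proof.
move=> cE; apply: (ord_chain_const (g := fun j => w u j (+) w u' j)) => j.
move: (cE j); rewrite /cv -/(lo j) -/(hi j).
by case: (w u (lo j)) (w u (hi j)) (w u' (lo j)) (w u' (hi j)) => -[] [] [].
Qed.

Lemma chain_model_qP u u' : code u' != c -> code u = code u' -> q u = q u'.
Proof.
move=> uc uu; move: uc; rewrite -uu; case: uu => /ffunP cE' eE uc.
have cE j : cv u j = cv u' j by have := cE' j; rewrite !ffunE.
apply: contraNeq uc => quu.
have wxor j : w u j = ~~ w u' j.
  have := cv_xor cE j; rewrite -(cv_xor cE ord_max) -/(q u) -/(q u').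
  by case: (q u) (q u') quu (w u j) (w u' j) => -[] // _ [] [].
rewrite codeP; apply/andP; split.
  apply/forallP => j; apply/eqP; apply: (ord_chain_const (g := w u)) => i.
  have := cE i; rewrite /cv !wxor -/(lo i) -/(hi i).
  by case: (w u' (lo i)) (w u' (hi i)) => -[].
(* One of the two bits of fork 0 is false, so the common report of [c0] is false. *)
move: eE; rewrite /ev; case: ifP => //= _ [].
by rewrite wxor; case: (w u' ord0); rewrite /= ?andbF // => ->.
Qed.

(** Within the class [c] all bits equal [q], and the identity would make [q] and [xbit] independent
    there; each mode violates this in its own way. *)
Lemma chain_model_contradiction : False.
Proof.
have N_gt0 : 0 < #|{: N}| by apply/card_gt0P; exists [ffun=> true].
have cvE u u' : w u =1 w u' -> cv u =1 cv u' by move=> wE j; rewrite /cv !wE.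
have code_zok u : code u = c -> zok u.
  case=> /ffunP cE _; apply/forallP => j; apply/implyP => _.
  by have := cE j; rewrite !ffunE => ->.
have xP u' : zok u' -> exists u, [&& xbit u, zok u & code u == code u'].
  (* This noise makes [x0] true without changing the code: [kap] is chosen to keep the report of
     [c0], or cleared if [mode] is false. *)
  move=> zu'; pose u := if mode then set_noise true (xi u' && kap u') u' else set_noise true false u'.
  have [wE xE kE] : [/\ w u =1 w u', xi u = true & kap u = mode && (xi u' && kap u')].
    rewrite /u; case: mode.
      by have [] := set_noiseE true (xi u' && kap u') u'.
    by have [] := set_noiseE true false u'.
  have zE : zok u = zok u' by apply: eq_forallb => j; rewrite (cvE _ _ wE).
  exists u; rewrite zE zu' /=.
  rewrite /xbit xE kE wE; apply/andP; split; first by case: mode; rewrite ?andbF.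
  rewrite (_ : code u = code u') // /code; congr (_, _).
    by apply/ffunP => j; rewrite !ffunE (cvE _ _ wE).
  rewrite /ev xE kE wE; case: mode => //=.
  by case: (w u' ord0); rewrite ?andbF ?andbT.
pose Q (v : cfg) := v y0 (W ord_max) == Some true.
have solQ (v : cfg) (u : {ffun V -> N}) (D : {set V}) :
    (forall i, i \notin D -> v i = F i v (u i)) -> D \subset X -> Q v = q u.
  by move=> vE sDX; rewrite /Q (chain_model_W vE sDX y0R) /q; case: (w u ord_max).
have QY (v v' : cfg) : {in Y, v =1 v'} -> Q v = Q v' by move=> vv; rewrite /Q vv.
have noise0 : exists u, zok u.
  exists (noise false false false); apply/code_zok/eqP; rewrite codeP.
  have [wE xE kE] := noiseE false false false; rewrite xE andbF andbT.
  by apply/forallP => j; rewrite !wE.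
have count := @mech_adjustment_count R V E X Y Z S dagE adjS _ _ t0 F locF N_gt0 x z Q
  q q xbit zok (fun u u' => code u == code u') QY
  (fun u => solQ _ _ _ (solxE u) (subxx _)) (fun u => chain_model_agree_z (solxE u) (subxx _))
  (fun u => solQ _ _ _ (solE u) (sub0set _)) chain_model_agree_x
  (fun u => chain_model_agree_z (solE u) (sub0set _)) chain_model_eqS noise0 xP.
have cross := class_cross (class_count count xP chain_model_qP code_zok).
have noise_c a b d : (code (noise a b d) == c) = ~~ (mode && [&& b, a & d]).
  have [wE xE kE] := noiseE a b d; rewrite codeP wE xE kE.
  by rewrite (_ : [forall j, _] = true) //; apply/forallP => j; rewrite !wE.
have noise_q a b d : q (noise a b d) = a by have [wE _ _] := noiseE a b d; rewrite /q wE.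
have q0 u : code u == c -> w u ord0 = q u by rewrite codeP => /andP[/forallP/(_ ord_max)/eqP].
(* In the class, [al] counts [q] with [xbit], [be'] neither, [al'] only [q], and [be] only
   [xbit]. *)
move: cross; set al := #|_|; set be' := #|_|; set al' := #|_|; set be := #|_| => cross.
have noise_x a b d : xbit (noise a b d) = if mode then b else ~~ (a && d).
  by have [wE xE kE] := noiseE a b d; rewrite /xbit wE xE kE.
case modeE: mode in noise_c noise_x.
  have flip_c u : code u == c -> q u || ~~ xi u -> code (flip u) == c.
    have [wE xE kE] := flipE u; move=> uc; rewrite -q0 //; move: uc.
    rewrite !codeP modeE /= => /andP[/forallP uw _] qx; rewrite xE wE; apply/andP; split.
      by apply/forallP => j; rewrite !wE (eqP (uw j)).
    by move: qx; case: (w u ord0) => //=; rewrite ?andbF // => /negbTE ->.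
  have flip_q u : q (flip u) = ~~ q u by have [wE _ _] := flipE u; rewrite /q wE.
  have flip_x u : xbit (flip u) = xbit u by have [_ xE _] := flipE u; rewrite /xbit modeE xE.
  have xbitE u : xbit u = xi u by rewrite /xbit modeE.
  have al_lt_be : al < be.
    rewrite /al -(card_imset _ flip_inj); apply: proper_card; apply/properP; split.
      apply/subsetP => _ /imsetP[u + ->]; rewrite !inE => /and3P[uc qu xu].
      by rewrite flip_c ?qu // flip_q qu flip_x xu.
    (* Flipping this assignment would make [c0] report true, which leaves the class. *)
    exists (noise false true true); first by rewrite !inE noise_c noise_q noise_x.
    apply/negP => /imsetP[u]; rewrite inE => /and3P[uc qu xu] nE.
    have [wE xE kE] := noiseE false true true.
    have [_ xF kF] := flipE u; rewrite -nE xE in xF; rewrite -nE kE in kF.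
    have w0 := q0 _ uc; move: uc; rewrite codeP modeE w0 qu -xF -kF.
    by rewrite andbF.
  have be'_le_al' : be' <= al'.
    rewrite /be' -(card_imset _ flip_inj); apply: subset_leq_card.
    apply/subsetP => _ /imsetP[u + ->]; rewrite !inE => /and3P[uc qu xu].
    by rewrite flip_c ?flip_q ?flip_x -?xbitE ?xu ?orbT // qu.
  have al'_gt0 : 0 < al'.
    by apply/card_gt0P; exists (noise true false true); rewrite !inE noise_c noise_q noise_x.
  (* The bounds give [al * be' <= al * al' < be * al']. *)
  by move: cross; nia.
(* With [mode] false, [xbit] fails only when the common bit is true. *)
have be'0 : be' = 0.
  apply: eq_card0 => u; rewrite !inE; apply/and3P => -[uc].
  by rewrite /xbit modeE q0 // => /negbTE->.
have be_gt0 : 0 < be.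
  by apply/card_gt0P; exists (noise false false false); rewrite !inE noise_c noise_q noise_x.
have al'_gt0 : 0 < al'.
  by apply/card_gt0P; exists (noise true false true); rewrite !inE noise_c noise_q noise_x.
by move: cross; rewrite be'0 muln0 => /esym/eqP; rewrite muln_eq0 !gtn_eqF.
Qed.

End ChainModel.

(** * Chains from open paths *)

Section OpenPaths.
Variables (V : finType) (E : rel V) (X Y Z S : {set V}).
Hypothesis dagE : dag E.
Let O := X :|: (S :|: Z).

Lemma path_reach (B : {set V}) a s : path E a s -> all (fun b => b \notin B) s -> reach E B a (last a s).
Proof.
move=> pas sB; apply/connectP; exists s => //; elim: s a pas sB => //= b s IHs a.
by case/andP=> ab pbs /andP[bB sB]; rewrite /avoid ab bB IHs.
Qed.

Lemma reach_step (B : {set V}) a b c : reach E B a b -> E b c -> c \notin B -> reach E B a c.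
Proof. by move=> ab bc cB; apply: connect_trans ab (connect1 _); apply/andP. Qed.

(** The last edge is unrestricted, since its target may be a collider in [S] or [Z], or a node of
    [X]. *)
Definition feeds r c := exists2 p, reach E O r p & E p c.
Definition observed c := exists2 o, o \in S :|: Z & reach E X c o.

(* The pairs in [l] are the successive colliders and forks (c_1, r_1), ...,
   (c_k, r_k) met from the fork [r] on. *)
Fixpoint chain y r (l : seq (V * V)) : Prop :=
  if l is (c, r') :: l'
  then [/\ feeds r c, feeds r' c, c \notin X & observed c] /\ r' \notin O /\ chain y r' l'
  else reach E O r y.

Lemma chain_reach y r l : chain y r l -> reach E O (last r (unzip2 l)) y.
Proof. by elim: l r => //= -[c r'] l IHl r [_ [_ /IHl]]. Qed.

Lemma chain_nth d y r l j : chain y r l -> j < size l ->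
  [/\ feeds (nth d (r :: unzip2 l) j) (nth d (unzip1 l) j),
      feeds (nth d (unzip2 l) j) (nth d (unzip1 l) j),
      nth d (unzip1 l) j \notin X, observed (nth d (unzip1 l) j) &
      nth d (unzip2 l) j \notin O].
Proof.
elim: l r j => //= -[c r'] l IHl r [|j] [[rc r'c cX co] [r'O ch]] //= lt_j.
exact: IHl ch lt_j.
Qed.

Definition backdoor_chain y :=
  exists x r l, [/\ x \in X, r \notin O, feeds r x & chain y r l].

(* A collider opened only through a node of X starts a back-door chain there. *)
Lemma observed_or_feeds c w : c \notin X -> w \in S :|: Z -> connect E c w ->
  observed c \/ c \notin O /\ exists2 x, x \in X & feeds c x.
Proof.
move=> + wSZ /connectP[s + wE]; elim: s c wE => [|b s IHs] c /= wE cX.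
  by left; exists c; rewrite -?wE //; apply: connect0.
case/andP=> cb pbs; have [cSZ|cSZ] := boolP (c \in S :|: Z).
  by left; exists c => //; apply: connect0.
have cO : c \notin O by rewrite inE negb_or cX.
have [bX|bX] := boolP (b \in X).
  by right; split=> //; exists b => //; exists c; first exact: connect0.
have [[o oSZ bo]|[bO [x xX [p bp px]]]] := IHs b wE bX pbs.
  by left; exists o => //; apply: connect_trans bo; apply: connect1; apply/andP.
right; split=> //; exists x => //; exists p => //.
by apply: connect_trans bp; apply: connect1; apply/andP.
Qed.

(** d-connection in a form suited to induction along the path: [a] precedes [t], and neither [a] nor
    the last node is constrained. *)
Fixpoint open_from a (t : seq V) : Prop :=
  match t with
  | b :: ((c :: _) as t') =>
    ((E a b && E c b -> exists2 w, w \in S :|: Z & connect E b w) /\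
     (~~ (E a b && E c b) -> b \notin S :|: Z)) /\ open_from b t'
  | _ => True
  end.

Lemma d_connecting_open a t : d_connecting E (S :|: Z) (a :: t) -> open_from a t.
Proof.
rewrite /d_connecting /collider_at => dc.
(* The default of [nth] was the first node; an arbitrary one survives passing to the tail. *)
have {dc} [d dc] : exists d, forall j, j.+1 < size t ->
    (E (nth d (a :: t) j) (nth d t j) && E (nth d t j.+1) (nth d t j) ->
       exists2 w, w \in S :|: Z & connect E (nth d t j) w) /\
    (~~ (E (nth d (a :: t) j) (nth d t j) && E (nth d t j.+1) (nth d t j)) ->
       nth d t j \notin S :|: Z).
  by exists a => j lt_j; apply: (dc j.+1).
elim: t a dc => // b [|c t] IHt a dc //.
by split; [apply: (dc 0) | apply: IHt => j lt_j; apply: (dc j.+1)].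
Qed.

(* The first alternative for [a] treats it as a non-collider, the second as a node
   entered by an arrow and carrying the bit of [r]. *)
Lemma open_path_chain y a t :
  path (adj E) a t -> all (fun b => b \notin X) t -> last a t = y -> y \notin O ->
  open_from a t ->
  backdoor_chain y \/
  (a \notin O -> exists r l, [/\ r \notin O, reach E O r a & chain y r l]) /\
  (forall r, (if t is b :: _ then E a b else true) -> reach E O r a ->
     path E a t /\ chain y r [::] \/ exists c r' l, chain y r ((c, r') :: l)).
Proof.
have [n] := ubnP (size t); elim: n a t => // n IHn a [|b t] /= lt_n.
  move=> _ _ aE yO _; right; split=> [aO|r _ ra]; last by left; rewrite -aE.
  by exists a, [::]; split=> //; rewrite /= -?aE; apply: connect0.
case/andP=> ab pbt /andP[bX tX] lastE yO opent.
have b_notinO : ~~ (E a b && (if t is c :: _ then E c b else false)) -> b \notin O.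
  by case: (t) lastE opent => [/= -> //|c t' _ /= [[_ nc] _] /nc bSZ]; rewrite inE negb_or bX.
have IHb : backdoor_chain y \/
  (b \notin O -> exists r l, [/\ r \notin O, reach E O r b & chain y r l]) /\
  (forall r, (if t is c :: _ then E b c else true) -> reach E O r b ->
     path E b t /\ chain y r [::] \/ exists c r' l, chain y r ((c, r') :: l)).
  by apply: IHn => //; case: (t) opent => //= c t' [].
case: IHb => [|[Gb Hb]]; first by left.
(* If the edge points to [a], then [b] is a non-collider and a fork found for [b] also serves
   [a]. *)
have [Eab|nEab] := boolP (E a b); last first.
  have Eba : E b a by move: ab; rewrite /adj (negbTE nEab).
  have bO : b \notin O by apply: b_notinO; rewrite (negbTE nEab).
  right; split=> // aO; have [r [l [rO rb ch]]] := Gb bO.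
  by exists r, l; split=> //; apply: reach_step rb Eba aO.
(* If [b] is no collider, the arrow leaving [a] goes on through [b], and [a], when outside [O], is
   itself the fork. *)
have [col|ncol] := boolP (if t is c :: _ then E c b else false); last first.
  have bO : b \notin O by apply: b_notinO; rewrite negb_and ncol orbT.
  have Ebt : (if t is c :: _ then E b c else true) : bool.
    by case: (t) ncol pbt => //= c t' ncol /andP[]; rewrite /adj (negbTE ncol) orbF.
  have Ha r : reach E O r a -> path E b t /\ chain y r [::] \/
      exists c r' l, chain y r ((c, r') :: l).
    by move=> ra; apply: Hb Ebt (reach_step ra Eab bO).
  right; split=> [aO|r _]; last exact: Ha.
  have [[_ ch]|[c [r' [l ch]]]] := Ha a (connect0 _ _).
    by exists a, [::]; split=> //; apply: connect0.
  by exists a, ((c, r') :: l); split=> //; apply: connect0.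
(* At a collider [a -> b <- c] the node [c] is a non-collider, and induction from [c] gives a fork
   above it. *)
case: t lt_n col pbt tX lastE opent {b_notinO Gb Hb} => // c t lt_n Ecb /=
  /andP[_ pct] /andP[cX tX] lastE [[obs_b _] opent].
have nEbc : ~~ E b c by apply: contraL (dagE Ecb) => /connect1->.
have cO : c \notin O.
  case: (t) lastE opent => [/= -> //|d t' _ /= [[_ nc] _]].
  by rewrite inE negb_or cX nc // (negbTE nEbc).
have opent' : open_from c t by case: (t) opent => //= d t' [].
have [|[Gc _]] := IHn c t (ltnW lt_n) pct tX lastE yO opent'; first by left.
have [r' [l [r'O r'c ch]]] := Gc cO.
have [w wSZ bw] := obs_b (introT andP (conj Eab Ecb)).
have [ob|[bO [x xX bx]]] := observed_or_feeds bX wSZ bw; last first.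
  left; exists x, r', l; split=> //; have [p bp px] := bx; exists p => //.
  by apply: connect_trans bp; apply: reach_step r'c Ecb bO.
have Ha r : reach E O r a -> chain y r ((b, r') :: l).
  by move=> ra; split=> //; split=> //; [exists a | exists c].
right; split=> [aO|r _ ra]; last by right; exists b, r', l; apply: Ha.
by exists a, ((b, r') :: l); split=> //; [apply: connect0 | apply/Ha/connect0].
Qed.

End OpenPaths.

(** * From a violated criterion to a model *)

Section Completeness.
Variables (R : realType) (V : finType) (E : rel V) (X Y Z S : {set V}).
Hypotheses (dagE : dag E) (adjS : cond_adjustment_set R E X Y Z S).
Hypotheses (disXY : [disjoint X & Y]) (disXZ : [disjoint X & Z]) (disXS : [disjoint X & S]).
Hypotheses (disYZ : [disjoint Y & Z]) (disYS : [disjoint Y & S]) (ZDe : Z :&: De E X = set0).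
Let O := X :|: (S :|: Z).

Lemma outcome_notin_O y : y \in Y -> y \notin O.
Proof.
by move=> yY; rewrite !inE (disjointFl disXY) // (disjointFr disYS) // (disjointFr disYZ).
Qed.

(** The list of colliders and forks becomes the indexed families of the chain model. *)
Lemma chain_contradiction (mode : bool) x c y r l :
  x \in X -> y \in Y -> r \notin O -> feeds E X Z S r c -> chain E X Z S y r l ->
  (if mode then [/\ c \notin X, feeds E X Z S x c & observed E X Z S c] else c = x) -> False.
Proof.
move=> xX yY rO [pw rpw pwc] ch modeP.
pose rr (j : 'I_(size l).+1) := nth r (r :: unzip2 l) j.
pose cc (j : 'I_(size l)) := nth r (unzip1 l) j.
have chP (j : 'I_(size l)) := chain_nth r ch (ltn_ord j).
have loP j : exists2 p, reach E O (rr (widen_ord (leqnSn _) j)) p & E p (cc j) by case: (chP j).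
have hiP j : exists2 p, reach E O (rr (lift ord0 j)) p & E p (cc j) by case: (chP j).
have [pl plR plE] := fin_all_exists2 loP; have [ph phR phE] := fin_all_exists2 hiP.
have rrO j : rr j \notin O.
  by rewrite /rr; case: j => -[|j] //= lt_j; case: (chain_nth r ch lt_j).
have ccX j : cc j \notin X by case: (chP j).
have ccobs j : exists2 o, o \in S :|: Z & reach E X (cc j) o by case: (chP j).
have yR : reach E O (rr ord_max) y.
  have := chain_reach ch; rewrite (last_nth r) size_map; exact.
have [px modeP'] : exists px, if mode
    then [/\ c \notin X, reach E O x px, E px c & exists2 o, o \in S :|: Z & reach E X c o]
    else c = x.
  case: mode modeP => [[cX [px xpx pxc] co]|->]; last by exists x.
  by exists px.
exact: (chain_model_contradiction dagE adjS disXZ disXS ZDe rrO ccX plR plE phR phE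
  ccobs yY yR xX rpw pwc modeP').
Qed.

Lemma backdoor_contradiction y : y \in Y -> ~ backdoor_chain E X Z S y.
Proof.
move=> yY [x [r [l [xX rO rx ch]]]].
exact: (@chain_contradiction false x x y r l).
Qed.

Lemma noncausal_paths_blocked s : is_path E s -> proper_from_to X Y s ->
  ~~ causal_path E s -> blocked E (S :|: Z) s.
Proof.
case: s => // x t /andP[_ pxt] /and3P[xX yY tX] ncausal /d_connecting_open opent.
have yO := outcome_notin_O yY.
have [|[_ H]] := open_path_chain dagE pxt tX (erefl _) yO opent.
  exact: backdoor_contradiction.
case: t pxt yY tX ncausal opent yO H => [|b t] //=.
case/andP=> xb pbt yY /andP[bX tX] ncausal opent yO H.
(* A non-causal path leaving [x] by an arrow meets a collider fed by [x]: [mode] is true. If the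
   arrow enters [x], a fork above [b] starts a back-door chain. *)
have [Exb|nExb] := boolP (E x b).
  have [[]|[c [r [l]]]] := H x Exb (connect0 _ _).
    by rewrite (negbTE ncausal).
  move=> [[xc rc cX co] [rO ch]].
  exact: (@chain_contradiction true x c (last b t) r l).
have Ebx : E b x by move: xb; rewrite /adj (negbTE nExb).
have bO : b \notin O.
  case: (t) yO opent => [//|c t' _ [[_ nc] _]].
  by rewrite inE negb_or bX nc // (negbTE nExb).
have opent' : open_from E Z S b t by case: (t) opent => //= c t' [].
have [|[G _]] := open_path_chain dagE pbt tX (erefl _) yO opent'.
  exact: backdoor_contradiction.
have [r [l [rO rb ch]]] := G bO.
by apply: (backdoor_contradiction yY); exists x, r, l; split=> //; exists b.
Qed.

Lemma adjustment_avoids_Forb w : w \in S -> ~ in_Forb E X Y w.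
Proof.
move=> wS [m [[|x t] [//= _ pxt /and3P[xX yY tX] mt]] mw].
have tZ : all (fun b => b \notin Z) t.
  apply/allP => b bt; apply: (descendant_notin_Z ZDe xX).
  by apply: (path_connect pxt); rewrite inE bt orbT.
have [tS|tS] := boolP (has (mem S) t).
  (* The first node of the path in [S] serves both as [m] and as [s0]. *)
  case: (split_find tS) pxt tX tZ yY => n t1 t2 nS t1S.
  rewrite cat_path rcons_path last_cat last_rcons !all_cat !all_rcons.
  case/andP=> /andP[pt1 pn] pt2 /andP[/andP[nX t1X] t2X] /andP[/andP[nZ t1Z] t2Z] yY.
  apply: (@mediator_model_contradiction R V E X Y Z S dagE adjS disXZ disXS ZDe
    x (last x t1) n (last n t2) n) => //.
  - apply: path_reach => //; apply/allP => b bt.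
    rewrite !inE !negb_or (allP t1X) // (allP t1Z) // andbT.
    by apply: contra t1S => bS; apply/hasP; exists b.
  - exact: path_reach.
  - exact: connect0.
have tO : all (fun b => b \notin O) t.
  apply/allP => b bt; rewrite !inE !negb_or (allP tX) // (allP tZ) // andbT.
  by apply: contra tS => bS; apply/hasP; exists b.
have xm : connect E x m by apply: (path_connect pxt); rewrite inE mt orbT.
have mX := allP tX m mt.
case/splitPr: mt pxt tO tX yY => t1 t2; rewrite cat_path last_cat !all_cat /=.
case/and3P=> pt1 pm pt2 /and3P[t1O mO t2O] /and3P[t1X _ t2X] yY.
have wSZ : w \in S :|: Z by rewrite inE wS.
(* Either [m] has an observed descendant, in [S] because descendants of [x] avoid [Z], or [m] is a
   fork feeding some [x'] and reaching the outcome. *)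
have [[o oSZ mo]|[_ [x' x'X mx']]] := observed_or_feeds mX wSZ mw.
  apply: (@mediator_model_contradiction R V E X Y Z S dagE adjS disXZ disXS ZDe
    x (last x t1) m (last m t2) o) => //.
  - exact: path_reach.
  - exact: path_reach.
  - move: oSZ; rewrite inE => /orP[//|oZ].
    have := descendant_notin_Z ZDe xX (connect_trans xm (reach_connect mo)).
    by rewrite oZ.
apply: (backdoor_contradiction yY); exists x', m, [::]; split=> //.
exact: path_reach.
Qed.

End Completeness.

Theorem mainTheorem10 (R : realType) (V : finType) (E : rel V)
    (X Y Z S : {set V}) :
  dag E ->
  [disjoint X & Y] -> [disjoint X & Z] -> [disjoint X & S] ->
  [disjoint Y & Z] -> [disjoint Y & S] -> [disjoint Z & S] ->
  Z :&: De E X = set0 ->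
  cond_adjustment_set R E X Y Z S ->
  cond_adj_criterion E X Y Z S.
Proof.
move=> dagE disXY disXZ disXS disYZ disYS _ ZDe adjS; split.
  by move=> w; apply: (adjustment_avoids_Forb dagE adjS).
by move=> s; apply: (noncausal_paths_blocked dagE adjS).
Qed.
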